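(* Let $n\ge2$, $r>1/2$, and let $F=\{f_1,\dots,f_n\}$ be a family of holomorphic functions on $B_r\subset\mathbb{C}^n$ such that, for some $M>0$, $$\sup_{B_r}\log|F|\le0\quad\text{and}\quad\inf_{\partial B_{1/2}}\log|F|\ge-M ,$$ and assume that all zeros of $|F|^2$ are elliptic. Assume that a compact set $K\subset\mathbb{C}^n$ belongs to $\mathcal{A}(d,a,b)$. Then $|F|$ satisfies the reverse Hölder inequality in each ball $B(x,t)\cap K$ with $B(x,4r^2t)\subset B_{1/2}$, and $\log|F|\in BMO(K,\mathcal{H}^d)$.
   Context: $B(x,t)$ is the open Euclidean ball in $\mathbb{C}^n$ with center $x$ and radius $t$, and $B_s=B(0,s)$. $|F|^2=|f_1|^2+\dots+|f_n|^2$. $\mathcal{H}^d$ is the $d$-dimensional Hausdorff measure. For $d,a,b>0$, a compact set $K\subset\mathbb{C}^n$ belongs to $\mathcal{A}(d,a,b)$ if $b s^d\le\mathcal{H}^d(K\cap B(y,s))\le a s^d$ for all $y\in K$ and $0<s\le\operatorname{diam}(K)$. Reverse Hölder inequality: with $K_{x,t}=B(x,t)\cap K$, $x\in K$, $t>0$, this is the inequality $$\left(\frac{1}{\mathcal{H}^d(K_{x,t})}\int_{K_{x,t}}|F|^{p}\,d\mathcal{H}^d\right)^{1/p}\le C\,\frac{1}{\mathcal{H}^d(K_{x,t})}\int_{K_{x,t}}|F|\,d\mathcal{H}^d$$ for any $1\le p\le\infty$ (for $p=\infty$ the left-hand side is the supremum of $|F|$ over $K_{x,t}$), with a constant $C=C(K,F,d)$.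 Elliptic zeros: let $h$ be a nonnegative (real-)analytic function with a finite number of zeros defined on an open set $U\subset\mathbb{R}^N$. A zero $x$ of $h$ is elliptic if the Taylor expansion of $h$ at $x$ has the form $h(x+t\theta)=t^{m}g(\theta)+o(t^{m})$ with $\inf_{S^{N-1}}g>0$; here $t>0$ and $\theta$ belongs to the unit sphere $S^{N-1}$ of $\mathbb{R}^N$. This is applied to $h=|F|^2$ with $\mathbb{C}^n\cong\mathbb{R}^{2n}$. The condition on $\partial B_{1/2}$ means that the system $F=0$ has only discrete zeros in a neighbourhood of the closed ball $\overline{B_{1/2}}$. For a complete metric space $X$ with a regular Borel measure $\mu$, a locally integrable function $u$ on $X$ belongs to $BMO(X,\mu)$ if $\sup_B\frac{1}{\mu(B)}\int_B|u-u_B|\,d\mu<\infty$, where $u_B=\frac1{\mu(B)}\int_B u\,d\mu$ and the supremum is over all metric balls $B\subset X$. Here $K$ carries the Euclidean metric.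
   Formalization: The BMO claim is stated for K contained in B_r, since log|F| is undefined outside B_r; the reverse Hölder claim is stated for K of positive diameter, since for a one-point K the averages are 0/0. *)

(* Defs.v *)
From HB Require Import structures.
From mathcomp Require Import all_boot all_order all_algebra.
From mathcomp Require Import all_classical all_reals all_analysis.
From mathcomp Require Import complex.
Set Implicit Arguments.
Unset Strict Implicit.
Unset Printing Implicit Defensive.
Import Order.TTheory GRing.Theory Num.Theory.
Import numFieldNormedType.Exports.
Local Open Scope classical_set_scope.
Local Open Scope ring_scope.

(* [R[i]] packed as a [numClosedFieldType], so that it carries the topology and
   the normed structure that the library gives to every such field. *)
Definition Cplx (R : realType) : numClosedFieldType := R[i].

Notation "'CV[' R ]_ n" := ('rV[Cplx R]_n)
  (at level 0, n at level 2, format "'CV[' R ]_ n") : type_scope.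

Section euclidean.
Variables (R : realType) (n : nat).
Implicit Types (x z : CV[R]_n) (A : set CV[R]_n).

(* The library norm on row vectors is the max norm; only the topology is taken
   from it (it is the Euclidean one). *)
Definition enorm z : R := Num.sqrt (\sum_i Normc.normc (z ord0 i) ^+ 2).

Definition eball x (t : R) : set CV[R]_n := [set z | enorm (z - x) < t].

Definition esphere x (t : R) : set CV[R]_n := [set z | enorm (z - x) = t].

(* [diam set0 = -oo] *)
Definition diam A : \bar R :=
  ereal_sup [set (enorm (p.1 - p.2))%:E | p in A `*` A].

End euclidean.

Section hausdorff_measure.
Variables (R : realType) (n : nat) (d : R).
Local Open Scope ereal_scope.
Implicit Types (A : set CV[R]_n) (U : (set CV[R]_n)^nat).

Definition diam_pow A : \bar R := if A == set0 then 0 else diam A `^ d.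

Definition fine_cover (delta : R) A : set (set CV[R]_n)^nat :=
  [set U | A `<=` \bigcup_k U k /\ forall k, diam (U k) <= delta%:E].

Definition hausdorff_content (delta : R) A : \bar R :=
  ereal_inf [set \sum_(k <oo) diam_pow (U k) | U in fine_cover delta A].

(* Not normalised by the volume of the unit ball. *)
Definition hausdorff A : \bar R :=
  ereal_sup [set hausdorff_content delta A | delta in [set e : R | (0 < e)%R]].

Lemma diam_pow_ge0 A : 0 <= diam_pow A.
Proof. by rewrite /diam_pow; case: ifP => // _; exact: poweR_ge0. Qed.

Lemma hausdorff_content_ge0 delta A : 0 <= hausdorff_content delta A.
Proof.
apply: le_ereal_inf_tmp => x [U _ <-]; apply: nneseries_ge0 => k _ _.
exact: diam_pow_ge0.
Qed.

Lemma le_hausdorff_content delta :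
  {homo hausdorff_content delta : A B / A `<=` B >-> A <= B}.
Proof.
move=> A B AB; apply/ereal_inf_le_tmp => x [U [BU dU]] <-.
by exists U => //; split => //; exact: subset_trans BU.
Qed.

Lemma hausdorff_content0 delta : hausdorff_content delta set0 = 0.
Proof.
apply/eqP; rewrite eq_le hausdorff_content_ge0 andbT.
apply: ereal_inf_lbound; exists (fun=> set0).
  split=> [//|k]; rewrite /diam setX0 image_set0 ereal_sup0; exact: leNye.
by apply: eseries0 => k _ _; rewrite /diam_pow eqxx.
Qed.

Lemma hausdorff_content_sigma_subadditive delta :
  sigma_subadditive (hausdorff_content delta).
Proof.
move=> A; have [[i ioo]|] :=
    pselect (exists i, hausdorff_content delta (A i) = +oo).
  rewrite (eseries_pinfty _ _ ioo) ?leey// => k _.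
  by rewrite -ltNye (lt_le_trans _ (hausdorff_content_ge0 _ _)).
rewrite -forallNE => Aoo.
suff add2e (e : {posnum R}) : hausdorff_content delta (\bigcup_k A k) <=
    \sum_(i <oo) hausdorff_content delta (A i) + e%:num%:E.
  by apply/lee_addgt0Pr => _/posnumP[].
rewrite (le_trans _ (epsilon_trick _ _ _))//; last first.
  by move=> k; exact: hausdorff_content_ge0.
pose P k U := fine_cover delta (A k) U /\
  \sum_(j <oo) diam_pow (U j) <=
    hausdorff_content delta (A k) + (e%:num / (2 ^ k.+1)%:R)%:E.
have [G PG] : {G : ((set CV[R]_n)^nat)^nat & forall k, P k (G k)}.
  apply: (@choice _ _ P) => k; rewrite /P /hausdorff_content.
  set S := (X in ereal_inf X); move infS : (ereal_inf S) => iS.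
  case: iS infS => [r Sr|Soo|Soo].
  - have en1 : (0 < e%:num / (2 ^ k.+1)%:R)%R by [].
    have /(lb_ereal_inf_adherent en1) : ereal_inf S \is a fin_num by rewrite Sr.
    move=> [x [U cU xS] Ux].
    by exists U; split => //; rewrite xS -Sr; exact/ltW.
  - by have := Aoo k; rewrite /hausdorff_content Soo.
  - by have := hausdorff_content_ge0 delta (A k);
      rewrite /hausdorff_content -/S Soo.
have G_ge0 x : 0 <= (diam_pow \o uncurry G) x by exact: diam_pow_ge0.
apply: (@le_trans _ _ (\esum_(i in setT) (diam_pow \o uncurry G) i)).
  rewrite /hausdorff_content; apply: ereal_inf_lbound => /=.
  have /card_esym/ppcard_eqP[f] := card_nat2.
  exists (uncurry G \o f).
    split => [t [i _]|k]; last first.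
      by rewrite /= /uncurry; case: (f k) => a b; exact: (PG a).1.2.
    move=> /((PG i).1.1) [j _ Gijt]; exists (f^-1%FUN (i, j)) => //=.
    by rewrite invK ?inE.
  rewrite -(esum_pred_image (diam_pow \o uncurry G) _ xpredT) ?[fun=> _]set_true//.
  by rewrite image_eq.
rewrite (_ : esum _ _ = \sum_(i <oo) \sum_(j <oo ) diam_pow (G i j)); last first.
  pose J : nat -> set (nat * nat) := fun i => [set (i, j) | j in setT].
  rewrite (_ : setT = \bigcup_k J k); last first.
    by rewrite predeqE => -[a b]; split => // _; exists a => //; exists b.
  rewrite esum_bigcupT /=; last 2 first.
    - apply/trivIsetP => i j _ _ ij.
      rewrite predeqE => -[k m] /=; split => //= -[] [_] _ [<-{k} _].
      by move=> [m' _] [] /esym/eqP; rewrite (negbTE ij).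
    - by move=> *; exact: diam_pow_ge0.
  rewrite -(image_id [set: nat]) -fun_true esum_pred_image//; last first.
    by move=> k _; apply: esum_ge0 => *; exact: diam_pow_ge0.
  apply: eq_eseriesr => /= j _.
  rewrite -(esum_pred_image (diam_pow \o uncurry G) (pair j) predT)//=; last 2 first.
  - by move=> *; exact: diam_pow_ge0.
  - by move=> ? ? _ _; exact: (@can_inj _ _ _ snd).
  by congr esum; rewrite predeqE => -[a b]; split; move=> [i _ <-]; exists i.
apply: lee_nneseries => [k _ _|k _]; last exact: (PG k).2.
by apply: nneseries_ge0 => *; exact: diam_pow_ge0.
Qed.

Lemma hausdorff_content_le delta A :
  (0 < delta)%R -> hausdorff_content delta A <= hausdorff A.
Proof. by move=> delta0; apply: ereal_sup_ubound; exists delta. Qed.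

Lemma hausdorff0 : hausdorff set0 = 0.
Proof.
apply/eqP; rewrite eq_le; apply/andP; split.
  by apply: ge_ereal_sup => _ [delta _ <-]; rewrite hausdorff_content0.
by apply: (le_trans (hausdorff_content_ge0 1 _)); exact: hausdorff_content_le.
Qed.

Lemma hausdorff_ge0 A : 0 <= hausdorff A.
Proof.
by apply: (le_trans (hausdorff_content_ge0 1 _)); exact: hausdorff_content_le.
Qed.

Lemma le_hausdorff : {homo hausdorff : A B / A `<=` B >-> A <= B}.
Proof.
move=> A B AB; apply: ge_ereal_sup => _ [delta delta0 <-].
apply: (le_trans (le_hausdorff_content _ AB)); exact: hausdorff_content_le.
Qed.

Lemma hausdorff_sigma_subadditive : sigma_subadditive hausdorff.
Proof.
move=> A; apply: ge_ereal_sup => _ [delta delta0 <-].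
apply: (le_trans (hausdorff_content_sigma_subadditive _ _)).
apply: lee_nneseries => [k _ _|k _]; first exact: hausdorff_content_ge0.
exact: hausdorff_content_le.
Qed.

HB.instance Definition _ := isOuterMeasure.Build R CV[R]_n hausdorff
  hausdorff0 hausdorff_ge0 le_hausdorff hausdorff_sigma_subadditive.

Definition hausdorff_outer : {outer_measure set CV[R]_n -> \bar R} :=
  hausdorff.

(* Hausdorff measure on the sigma-algebra of its Caratheodory-measurable sets
   (which contains the Borel sets). *)
Definition hausdorff_measure :
    {measure set (caratheodory_type hausdorff_outer) -> \bar R} :=
  hausdorff_outer : set (caratheodory_type hausdorff_outer) -> \bar R.

End hausdorff_measure.

Section metric_measure_averages.
Variables (R : realType) (n : nat) (d : R).
Local Open Scope ereal_scope.
Let T := caratheodory_type (hausdorff_outer n d).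
Let mu := hausdorff_measure n d.
Implicit Types (K B : set CV[R]_n).

(* The inverse of [0] in [\bar R] is [+oo], so that [average B u = 0] when
   [mu B = 0]. *)
Definition average B (u : CV[R]_n -> \bar R) : \bar R :=
  (mu B)^-1 * \int[mu]_(z in (B : set T)) u z.

(* The value at [p = -oo] is not used. *)
Definition power_mean (p : \bar R) B (u : CV[R]_n -> R) : \bar R :=
  match p with
  | p%:E => average B (fun z => (u z `^ p)%:E) `^ p^-1
  | +oo => ereal_sup [set (u z)%:E | z in B]
  | -oo => 0
  end.

Definition reverse_Holder (C : R) B (u : CV[R]_n -> R) : Prop :=
  forall p : \bar R, 1 <= p ->
    power_mean p B u <= C%:E * average B (fun z => (u z)%:E).

(* Balls of the metric space [K]: centred in [K] and intersected with it. *)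
Definition metric_balls K : set (set CV[R]_n) :=
  [set B | exists x s, [/\ K x, (0 < s)%R & B = eball x s `&` K]].

Definition locally_integrable_on K (u : CV[R]_n -> \bar R) : Prop :=
  forall x, K x -> exists2 s : R, (0 < s)%R &
    mu.-integrable (eball x s `&` K : set T) u.

Definition BMO K (u : CV[R]_n -> \bar R) : Prop :=
  locally_integrable_on K u /\
  ereal_sup [set average B (fun z => `|u z - average B u|) |
             B in metric_balls K] < +oo.

Definition regular_class (a b : R) K : Prop :=
  compact K /\
  forall y, K y -> forall s : R, (0 < s)%R -> s%:E <= diam K ->
    (b * s `^ d)%:E <= mu (eball y s `&` K) <= (a * s `^ d)%:E.

End metric_measure_averages.

Section elliptic_zeros.
Variable R : realType.

Definition unit_sphere (N : nat) : set 'rV[R]_N :=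
  [set theta | \sum_i theta ord0 i ^+ 2 = 1].

Definition homogeneous_poly_fun (N m : nat) (g : 'rV[R]_N -> R) : Prop :=
  exists c : {ffun 'I_N -> 'I_m.+1} -> R, forall v,
    g v = \sum_(k : {ffun 'I_N -> 'I_m.+1} | (\sum_i k i)%N == m)
            c k * \prod_i v ord0 i ^+ k i.

(* [g] is the first nonzero term of the Taylor expansion, hence a homogeneous
   polynomial, and the remainder is uniform in the direction [theta]. *)
Definition elliptic_zero (N : nat) (h : 'rV[R]_N -> R) (x : 'rV[R]_N) : Prop :=
  h x = 0 /\
  exists (m : nat) (g : 'rV[R]_N -> R),
    [/\ homogeneous_poly_fun m g,
        forall e : R, 0 < e -> \forall t \near 0^'+,
          forall theta, unit_sphere theta ->
            `|h (x + t *: theta) - t ^+ m * g theta| <= e * t ^+ m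
      & 0 < inf [set g theta | theta in @unit_sphere N]].

Definition complexify (n : nat) (v : 'rV[R]_(n + n)) : CV[R]_n :=
  \row_j (lsubmx v ord0 j +i* rsubmx v ord0 j)%C.

End elliptic_zeros.

Section holomorphic_families.
Variables (R : realType) (n : nat).
Implicit Type f : 'I_n -> CV[R]_n -> Cplx R.

(* Frechet differentiability over the complex field. *)
Definition holomorphic_on (D : set CV[R]_n) (f : CV[R]_n -> Cplx R) : Prop :=
  forall z, D z -> differentiable f z.

Definition family_norm f (z : CV[R]_n) : R := enorm (\row_i f i z).

(* [lne 0 = -oo] *)
Definition log_family_norm f (z : CV[R]_n) : \bar R := lne (family_norm f z)%:E.

End holomorphic_families.

(* Main.v *)
Require Import Defs.
From HB Require Import structures.
From mathcomp Require Import all_boot all_order all_algebra.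
From mathcomp Require Import all_classical all_reals all_analysis.
From mathcomp Require Import measurable_realfun.
From mathcomp Require Import complex ring lra.
Set Implicit Arguments.
Unset Strict Implicit.
Unset Printing Implicit Defensive.
Import Order.TTheory GRing.Theory Num.Theory.
Import numFieldNormedType.Exports.
Local Open Scope classical_set_scope.
Local Open Scope ring_scope.

(* Ellipticity gives |F(z)|^2 ~ |z - p|^m near each zero p, so by compactness
   |F|^2 is comparable, on the part S of K which matters, to a finite product of
   factors |z - w|.  For a ball B of K of centre x and radius s, and
   rho = |x - w| + s, the function ln rho - ln |z - w| is nonnegative on B and is
   at most ln 2 times the number of k with |z - w| < rho / 2^k; by regularity of
   K these sets have measure O(2^(-kd)) mu(B), so its mean over B is bounded.
   Summing over the factors, on each ball B there is a constant L >= ln |F| such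
   that the mean of L - ln |F| is at most an absolute constant C.  This bounds the
   mean oscillation by 2C, and by Jensen e^L <= e^C mean |F|, which is the reverse
   Hoelder inequality for p = +oo and hence for all p.
   Borel sets are Hausdorff measurable because Hausdorff measure is additive on
   sets at positive distance. *)


(** * The Euclidean norm and the topology it induces *)

Section enorm_theory.
Variables (R : realType) (n : nat).
Implicit Types (x y z : CV[R]_n).

Lemma normc_ge0 (c : Cplx R) : 0 <= Normc.normc c.
Proof. by case: c => u v; exact: sqrtr_ge0. Qed.

Lemma normr_Cplx (c : Cplx R) : `|c| = ((Normc.normc c)%:C)%C :> Cplx R.
Proof. by case: c. Qed.

Lemma enorm_ge0 z : 0 <= enorm z.
Proof. exact: sqrtr_ge0. Qed.

Lemma sqr_enorm z : enorm z ^+ 2 = \sum_i Normc.normc (z ord0 i) ^+ 2.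
Proof. by rewrite sqr_sqrtr// sumr_ge0// => i _; exact: sqr_ge0. Qed.

Lemma normc_le_enorm z i : Normc.normc (z ord0 i) <= enorm z.
Proof.
rewrite -(ler_pXn2r (ltn0Sn 1)) ?nnegrE ?normc_ge0 ?enorm_ge0//.
rewrite sqr_enorm (bigD1 i)//= lerDl sumr_ge0// => j _; exact: sqr_ge0.
Qed.

Lemma enorm_le_sum z : enorm z <= \sum_i Normc.normc (z ord0 i).
Proof.
have S0 (P : pred 'I_n) : 0 <= \sum_(i | P i) Normc.normc (z ord0 i).
  by apply: sumr_ge0 => i _; exact: normc_ge0.
rewrite -(ler_pXn2r (ltn0Sn 1)) ?nnegrE ?enorm_ge0 ?S0//.
rewrite sqr_enorm [leRHS]expr2 mulr_suml ler_sum// => i _.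
by rewrite expr2 ler_wpM2l ?normc_ge0// (bigD1 i)//= lerDl S0.
Qed.

Lemma enorm_le_unif z (e : R) :
  (forall i, Normc.normc (z ord0 i) <= e) -> enorm z <= n%:R * e.
Proof.
move=> ze; apply: (le_trans (enorm_le_sum z)).
apply: (le_trans (ler_sum _ (fun i _ => ze i))).
by rewrite sumr_const card_ord mulr_natl.
Qed.

Lemma enorm0 : enorm (0 : CV[R]_n) = 0.
Proof.
by rewrite /enorm big1 ?sqrtr0// => i _; rewrite mxE Normc.normc0 expr0n.
Qed.

Lemma enorm_eq0 z : enorm z = 0 -> z = 0.
Proof.
move=> z0; apply/rowP => i; rewrite mxE.
by apply: Normc.eq0_normc; apply/eqP; rewrite eq_le normc_ge0 -z0 normc_le_enorm.
Qed.

Lemma enormN z : enorm (- z) = enorm z.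
Proof.
congr Num.sqrt; apply: eq_bigr => i _; rewrite mxE.
by case: (z ord0 i) => u v /=; rewrite !sqrrN.
Qed.

(** With A = |x| and B = |y|, the weighted bound (u + v)^2 <= (1 + B/A) u^2 + (1 + A/B) v^2 in each
    coordinate sums to (A + B)^2, which avoids a separate Cauchy-Schwarz inequality. The cases A = 0
    and B = 0 come first because of the divisions. *)
Lemma ler_enormD x y : enorm (x + y) <= enorm x + enorm y.
Proof.
have [x0|x0] := eqVneq (enorm x) 0.
  by rewrite (enorm_eq0 x0) add0r enorm0 add0r.
have [y0|y0] := eqVneq (enorm y) 0.
  by rewrite (enorm_eq0 y0) addr0 enorm0 addr0.
have A0 : 0 < enorm x by rewrite lt_neqAle eq_sym x0 enorm_ge0.
have B0 : 0 < enorm y by rewrite lt_neqAle eq_sym y0 enorm_ge0.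
rewrite -(ler_pXn2r (ltn0Sn 1)) ?nnegrE ?addr_ge0 ?enorm_ge0//.
rewrite sqr_enorm; set A := enorm x in A0 *; set B := enorm y in B0 *.
apply: (@le_trans _ _ (\sum_i ((1 + B / A) * Normc.normc (x ord0 i) ^+ 2 +
    (1 + A / B) * Normc.normc (y ord0 i) ^+ 2))).
  apply: ler_sum => i _; rewrite mxE.
  apply: (@le_trans _ _ ((Normc.normc (x ord0 i) + Normc.normc (y ord0 i)) ^+ 2)).
    rewrite ler_pXn2r// ?nnegrE ?addr_ge0 ?normc_ge0//.
    exact: le_normcD.
  set u := Normc.normc _; set v := Normc.normc _.
  rewrite -subr_ge0.
  rewrite (_ : _ - _ = (B * u - A * v) ^+ 2 / (A * B)); last by field; rewrite !gt_eqF.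
  by rewrite divr_ge0 ?sqr_ge0// mulr_ge0 ?enorm_ge0.
rewrite big_split/= -!mulr_sumr -!sqr_enorm -/A -/B.
by rewrite le_eqVlt; apply/orP; left; apply/eqP; field; rewrite !gt_eqF.
Qed.

Lemma enorm_distC x y : enorm (x - y) = enorm (y - x).
Proof. by rewrite -enormN opprB. Qed.

Lemma ler_enorm_trans y x z : enorm (x - z) <= enorm (x - y) + enorm (y - z).
Proof. by rewrite (le_trans _ (ler_enormD _ _))// addrA subrK. Qed.

Lemma ler_dist_enorm x y : `|enorm x - enorm y| <= enorm (x - y).
Proof.
rewrite ler_norml; apply/andP; split.
  by have := ler_enormD (y - x) x; rewrite subrK enorm_distC; lra.
by have := ler_enormD (x - y) y; rewrite subrK; lra.
Qed.

Lemma subset_eball x y (s t : R) :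
  enorm (x - y) + s <= t -> eball x s `<=` eball y t.
Proof.
rewrite /eball => xyst z /= zx; have := ler_enorm_trans x z y; lra.
Qed.

(** The bridge between the library topology, given by the max norm with radii in [Cplx R], and
    Euclidean balls with real radii. *)
Lemma nbhs_eball x (P : set CV[R]_n) :
  nbhs x P <-> exists2 e : R, 0 < e & eball x e `<=` P.
Proof.
split.
  move=> /nbhs_ballP[e e0 eP].
  (* A positive element of [Cplx R] has zero imaginary part and positive real part. *)
  move: e0; rewrite /= ltcE /= => /andP[/eqP e1 e0].
  exists (complex.Re e) => // z /= zx; apply: eP.
  split=> [|i j]; first by rewrite ltcE /= e1 eqxx.
  rewrite (ord1 i) /ball/= normr_Cplx ltcE /= e1 eqxx /=.
  apply: le_lt_trans zx; rewrite enorm_distC.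
  by have := normc_le_enorm (x - z) j; rewrite !mxE.
move=> [e e0 eP]; apply/nbhs_ballP.
(* Dividing by n + 1 keeps n e' strictly below e and also makes sense for n = 0. *)
pose e' : R := e / n.+1%:R.
have e'0 : 0 < e' by rewrite divr_gt0.
exists ((e'%:C)%C : Cplx R); first by rewrite /= ltcE /= eqxx.
move=> z zx; apply: eP => /=.
apply: (@le_lt_trans _ _ (n%:R * e')).
  apply: enorm_le_unif => i; rewrite !mxE.
  have [_ /(_ ord0 i)] := zx; rewrite /ball/= normr_Cplx ltcE /= => /andP[_ h].
  by rewrite -normcN opprB; exact: ltW.
by rewrite /e' mulrCA gtr_pMr// ltr_pdivrMr// mul1r ltr_nat.
Qed.

Lemma open_eball x (t : R) : open (eball x t).
Proof.
rewrite openE => y /= yx; apply/nbhs_eball; exists (t - enorm (y - x)).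
  by rewrite subr_gt0.
by apply: subset_eball; lra.
Qed.

Lemma continuous_at_eball (g : CV[R]_n -> R) x :
  (forall e : R, 0 < e ->
     exists2 s : R, 0 < s & forall z, eball x s z -> `|g z - g x| <= e) ->
  {for x, continuous g}.
Proof.
move=> gx; apply/cvgrPdist_le; first exact: (@nbhs_filter CV[R]_n x).
move=> e /gx[s s0 sg].
by apply/nbhs_eball; exists s => // z /sg; rewrite distrC.
Qed.

Lemma continuous_enormB w : continuous (fun z => enorm (z - w)).
Proof.
move=> x; apply: continuous_at_eball => e e0; exists e => // z /= zx.
rewrite (le_trans (ler_dist_enorm _ _))//.
by rewrite (_ : z - w - _ = z - x) ?ltW// opprB addrA subrK.
Qed.

Lemma closed_closed_eball x (t : R) : closed [set z | enorm (z - x) <= t].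
Proof.
exact: (closed_comp (fun z _ => @continuous_enormB x z) (@closed_le _ t)).
Qed.

Lemma compact_eball_cover (S : set CV[R]_n) (e : CV[R]_n -> R) :
  compact S -> (forall p, S p -> 0 < e p) ->
  exists2 ps : seq CV[R]_n, (forall p, p \in ps -> S p) &
    forall z, S z -> exists2 p, p \in ps & eball p (e p) z.
Proof.
rewrite compact_cover => cS e0.
have [||D DS Scov] := cS _ S (fun p => eball p (e p)).
- by move=> p _; exact: open_eball.
- by move=> z Sz; exists z => //; rewrite /eball /= subrr enorm0 e0.
exists (finmap.enum_fset D) => [p pD|z Sz].
  by have := DS p; rewrite !inE; apply.
by have [p pD zp] := Scov _ Sz; exists p.
Qed.

End enorm_theory.


(** * Hausdorff measure is a metric outer measure *)

Section layers.
Variables (T : Type) (R : realType) (mu : {outer_measure set T -> \bar R}).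
Variable rho : T -> R.

(** Separation is measured through [rho], as [T] carries no metric; for a 1-Lipschitz [rho] it
    implies positive distance. *)
Definition separated_by (A B : set T) :=
  exists2 e : R, 0 < e & forall x y, A x -> B y -> e <= `|rho x - rho y|.

Hypothesis mu_separated : forall A B, separated_by A B ->
  (mu A + mu B <= mu (A `|` B))%E.

Let above (k : nat) : set T := [set x | (k.+1%:R^-1 < rho x)%R].
(** The part of [above j.+2] outside [above j.+1]. *)
Let layer (j : nat) : set T :=
  [set x | (j.+3%:R^-1 < rho x)%R && (rho x <= j.+2%:R^-1)%R].

Let invS_lt (j k : nat) : (j < k)%N -> k.+1%:R^-1 < j.+1%:R^-1 :> R.
Proof. by move=> jk; rewrite ltf_pV2 ?posrE// ltr_nat. Qed.

Let invS_le (j k : nat) : (j <= k)%N -> k.+1%:R^-1 <= j.+1%:R^-1 :> R.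
Proof. by move=> jk; rewrite lef_pV2 ?posrE// ler_nat. Qed.

(** Skipping every other layer leaves a gap: on [above (N.*2 + c)] the function exceeds 1/(2N+c+1),
    on the next layer used it is at most 1/(2N+c+2). Additivity on separated sets then gives the
    bound by induction. *)
Let alternate_layers X c N :
  (\sum_(j < N) mu (X `&` layer (j.*2 + c)) <= mu (X `&` above (N.*2 + c)))%E.
Proof.
elim: N => [|N IH]; first by rewrite big_ord0 outer_measure_ge0.
rewrite big_ord_recr/=; apply: (le_trans (leeD2r _ IH)).
apply: (le_trans (mu_separated _)).
  exists ((N.*2 + c).+1%:R^-1 - (N.*2 + c).+2%:R^-1).
    by rewrite subr_gt0 invS_lt.
  move=> x y [_ /= xN] [_ /= /andP[_ yN]].
  by rewrite (le_trans _ (ler_norm _))// lerB// ltW.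
rewrite -setIUr; apply: le_outer_measure; apply: setIS => x [|] /=.
  by apply: le_lt_trans; rewrite invS_le// leq_add2r leq_double.
by move=> /andP[+ _].
Qed.

Let layers_lty X : (mu X < +oo)%E ->
  (\sum_(0 <= j <oo) mu (X `&` layer j) < +oo)%E.
Proof.
move=> Xoo; apply: (@le_lt_trans _ _ (mu X + mu X)%E); last first.
  by rewrite lte_add_pinfty.
apply: lime_le; first by apply: is_cvg_nneseries => *; exact: outer_measure_ge0.
near=> N.
apply: (@le_trans _ _ (\sum_(0 <= j < N.*2) mu (X `&` layer j))%E).
  rewrite [leRHS](big_cat_nat (n := N))//=; last by rewrite -addnn leq_addr.
  by rewrite leeDl// sume_ge0// => *; exact: outer_measure_ge0.
rewrite (_ : (\sum_(0 <= j < N.*2) _)%E = (\sum_(j < N) mu (X `&` layer (j.*2 + 0)) +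
     \sum_(j < N) mu (X `&` layer (j.*2 + 1)))%E); last first.
  rewrite -big_split/=; elim: (N) => [|m IH]; first by rewrite big_nil big_ord0.
  by rewrite doubleS !big_nat_recr// big_ord_recr/= IH addn0 addn1 addeA.
by apply: leeD; apply: (le_trans (alternate_layers _ _ _)); apply: le_outer_measure.
Unshelve. all: by end_near. Qed.

Let exhaustion (X : set T) k :
  X `&` [set x | 0 < rho x] `<=`
  (X `&` above k.+1) `|` \bigcup_(j in ~` `I_k) (X `&` layer j).
Proof.
move=> x [Xx /= x0]; have [kx|xk] := ltP k.+2%:R^-1 (rho x); first by left.
right.
have exj : exists j, j.+3%:R^-1 < rho x.
  exists (Num.bound (rho x)^-1); rewrite invf_plt ?posrE//.
  apply: (@lt_le_trans _ _ (Num.bound (rho x)^-1)%:R).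
    by apply: archi_boundP; rewrite invr_ge0 ltW.
  by rewrite ler_nat -addn3 leq_addr.
have [j jx jmin] := ex_minnP exj.
exists j => /=.
  move=> jk; move: jx; rewrite ltNge => /negP; apply.
  by apply: (le_trans xk); exact: invS_le.
split=> //; rewrite /layer/= jx/=.
(* For j = 0 minimality says nothing, and the upper bound 1/2 comes from [xk]. *)
case: j jx jmin => [_ _|j jx jmin].
  by apply: (le_trans xk); exact: invS_le.
by rewrite leNgt; apply/negP => /jmin; rewrite ltnn.
Qed.

(* The sets [X & above k] exhaust [X & {rho > 0}] up to the tail of a series
   which converges because the layers of even index, and those of odd index, are
   pairwise separated. *)
Lemma caratheodory_measurable_gt0 : mu.-caratheodory [set x | 0 < rho x].
Proof.
apply: le_caratheodory_measurable => X.
have [Xoo|] := ltP (mu X) +oo%E; last by rewrite leye_eq => /eqP ->; exact: leey.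
have U0 : ~` [set x | 0 < rho x] = [set x | rho x <= 0].
  by apply/seteqP; split => x /=; [move/negP; rewrite -leNgt|rewrite leNgt => /negP].
apply/lee_addgt0Pr => e e0.
have := nneseries_tail_cvg (layers_lty Xoo)
  (fun k _ => outer_measure_ge0 mu _).
move=> /(_ [set u | (u < e%:E)%E]) [].
  by apply: open_nbhs_nbhs; split; [exact: open_ereal_lt_ereal|rewrite /= lte_fin].
move=> k _ /(_ k (leqnn k)) /= /ltW tail_e.
have sep : separated_by (X `&` above k.+1) (X `&` [set x | rho x <= 0]).
  exists k.+2%:R^-1; first by rewrite invr_gt0.
  move=> x y [_ xk] [_ /= y0]; rewrite (le_trans _ (ler_norm _))//.
  by rewrite (le_trans (ltW xk))// lerDl oppr_ge0.
rewrite U0; apply: (@le_trans _ _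
    (mu (X `&` above k.+1) + e%:E + mu (X `&` [set x | (rho x <= 0)%R]))%E).
  apply: leeD2r; apply: (le_trans (le_outer_measure mu _ _ (@exhaustion X k))).
  apply: (le_trans (outer_measureU2 _ _ _)); apply: leeD2l.
  exact: (le_trans (outer_measure_sigma_subadditive_tail _ _ _) tail_e).
rewrite addeAC leeD2r// (le_trans (mu_separated sep))// le_outer_measure//.
by rewrite -setIUr; exact: subIsetl.
Qed.

End layers.

(** * Hausdorff measurability of open and closed sets *)

Section hausdorff_borel.
Variables (R : realType) (n : nat) (d : R).
Local Open Scope ereal_scope.
Implicit Types A B U : set CV[R]_n.
Notation H := (hausdorff d).

(** Members of a cover that miss [A] are replaced by [set0], of zero [diam_pow], so that the
    sequence keeps its indexing. *)
Let hit A U : set CV[R]_n := if pselect (U `&` A !=set0) then U else set0.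

Let diam_hit A U (e : R) : diam U <= e%:E -> diam (hit A U) <= e%:E.
Proof.
rewrite /hit; case: (pselect (U `&` A !=set0)) => //= _ _.
by rewrite /diam setX0 image_set0 ereal_sup0 leNye.
Qed.

Let diam_pow_hit A B U (e e' : R) : (e < e')%R ->
  (forall x y, A x -> B y -> (e' <= enorm (x - y))%R) -> diam U <= e%:E ->
  diam_pow d (hit A U) + diam_pow d (hit B U) <= diam_pow d U.
Proof.
have d0 : diam_pow d (set0 : set CV[R]_n) = 0 by rewrite /diam_pow eqxx.
move=> ee' AB Ue; rewrite /hit;
case: (pselect (U `&` A !=set0)) => /= [[x [Ux Ax]]|_]; last first.
  by case: (pselect (U `&` B !=set0)) => /= [_|_]; rewrite ?d0 !add0e// diam_pow_ge0.
case: (pselect (U `&` B !=set0)) => /= [[y [Uy By]]|_]; last by rewrite d0 adde0.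
have := AB _ _ Ax By; rewrite leNgt => /negP; case.
apply: le_lt_trans ee'; rewrite -lee_fin; apply: le_trans Ue.
by apply: ereal_sup_ubound; exists (x, y).
Qed.

(** A set of diameter at most [e] cannot meet both [A] and [B], so filtering a cover of the union by
    [hit] yields covers of [A] and of [B] that share no nonempty member. *)
Lemma hausdorff_content_separated A B (e e' : R) : (e < e')%R ->
  (forall x y, A x -> B y -> (e' <= enorm (x - y))%R) ->
  hausdorff_content d e A + hausdorff_content d e B <=
  hausdorff_content d e (A `|` B).
Proof.
move=> ee' AB; apply: le_ereal_inf_tmp => _ [U [covU dU] <-].
apply: (@le_trans _ _ (\sum_(0 <= k <oo) diam_pow d (hit A (U k)) +
    \sum_(0 <= k <oo) diam_pow d (hit B (U k)))).
  apply: leeD; apply: ereal_inf_lbound.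
  - exists (fun k => hit A (U k)) => //; split=> [x Ax|k]; last exact: diam_hit.
    have [k _ Ukx] := covU x (or_introl Ax); exists k => //.
    by rewrite /hit; case: pselect => // -[]; exists x.
  - exists (fun k => hit B (U k)) => //; split=> [x Bx|k]; last exact: diam_hit.
    have [k _ Ukx] := covU x (or_intror Bx); exists k => //.
    by rewrite /hit; case: pselect => // -[]; exists x.
rewrite -nneseriesD; [|by move=> *; exact: diam_pow_ge0..].
apply: lee_nneseries => [k _ _|k _]; first by rewrite adde_ge0 ?diam_pow_ge0.
exact: diam_pow_hit ee' AB (dU k).
Qed.

Lemma hausdorff_content_nincr (e e' : R) A : (e <= e')%R ->
  hausdorff_content d e' A <= hausdorff_content d e A.
Proof.
move=> ee'; apply: ereal_inf_le_tmp => _ [U [AU dU] <-]; exists U => //.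
by split=> // k; rewrite (le_trans (dU k))// lee_fin.
Qed.

Lemma hausdorff_separated A B (e : R) : (0 < e)%R ->
  (forall x y, A x -> B y -> (e <= enorm (x - y))%R) ->
  H A + H B <= H (A `|` B).
Proof.
move=> e0 AB.
have key (s t : R) : (0 < s)%R -> (0 < t)%R ->
    hausdorff_content d s A + hausdorff_content d t B <= H (A `|` B).
  (* A common mesh finer than both [s] and [t], and below the distance [e], only increases the two
     contents. *)
  move=> s0 t0; pose m := Num.min (Num.min s t) (e / 2)%R.
  have m0 : (0 < m)%R by rewrite !lt_min s0 t0 divr_gt0.
  apply: le_trans (hausdorff_content_le d (A `|` B) m0).
  apply: le_trans (hausdorff_content_separated (e' := e) _ AB).
    by apply: leeD; apply: hausdorff_content_nincr; rewrite !ge_min lexx ?orbT.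
  by rewrite gt_min; apply/orP; right; lra.
(* Once the union has finite measure, all terms are finite, and the suprema over [s] and [t] can be
   taken one after the other by subtraction. *)
have [AB_oo|] := ltP (H (A `|` B)) +oo; last by rewrite leye_eq => /eqP ->; exact: leey.
have fin C : C `<=` A `|` B -> H C \is a fin_num.
  move=> CAB; rewrite ge0_fin_numE ?hausdorff_ge0// (le_lt_trans _ AB_oo)//.
  exact: le_hausdorff.
have finA := fin A (@subsetUl _ A B); have finB := fin B (@subsetUr _ A B).
have keyB (s : R) : (0 < s)%R -> hausdorff_content d s A <= H (A `|` B) - H B.
  move=> s0; rewrite leeBrDr//; rewrite addeC -leeBrDr; last first.
    rewrite ge0_fin_numE ?hausdorff_content_ge0//.
    rewrite (le_lt_trans (hausdorff_content_le d A s0))// ltey_eq.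
    by rewrite finA.
  apply: ge_ereal_sup => _ [t /= t0 <-]; rewrite leeBrDr; last first.
    rewrite ge0_fin_numE ?hausdorff_content_ge0//.
    rewrite (le_lt_trans (hausdorff_content_le d A s0))// ltey_eq.
    by rewrite finA.
  by rewrite addeC key.
rewrite -leeBrDr//; apply: ge_ereal_sup => _ [s /= s0 <-]; exact: keyB.
Qed.

Let T := caratheodory_type (hausdorff_outer n d).

Lemma hausdorff_measurable_gt0 (rho : CV[R]_n -> R) :
  (forall x y, `|rho x - rho y| <= enorm (x - y))%R ->
  measurable ([set x | 0 < rho x]%R : set T).
Proof.
move=> lip; apply: caratheodory_measurable_gt0 => A B [e e0 AB].
by apply: (hausdorff_separated e0) => x y Ax By; rewrite (le_trans (AB _ _ Ax By)).
Qed.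

(** An open set is the positivity set of the distance to its complement, which is 1-Lipschitz. The
    whole space is separate because its complement has no distance function. *)
Lemma hausdorff_measurable_open A : open A -> measurable (A : set T).
Proof.
move=> oA; have [[c Ac]|A0] := pselect (~` A !=set0); last first.
  rewrite (_ : A = setT); first exact: measurableT.
  by apply/seteqP; split => // x _; apply: contrapT => nAx; apply: A0; exists x.
pose D x := [set enorm (x - c) | c in ~` A].
have D0 x : D x !=set0 by exists (enorm (x - c)); exists c.
have Dlb x : has_lbound (D x).
  by exists 0%R => _ [y _ <-]; exact: enorm_ge0.
have lip x y : (inf (D x) - inf (D y) <= enorm (x - y))%R.
  rewrite lerBlDr -lerBlDl; apply: lb_le_inf => // _ [z nAz <-].
  rewrite lerBlDl (le_trans _ (ler_enorm_trans y x z))//.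
  by apply: ge_inf => //; exists z.
rewrite (_ : A = [set x | 0 < inf (D x)]%R).
  apply: hausdorff_measurable_gt0 => x y; rewrite ler_norml lip andbT.
  by rewrite lerNl opprB enorm_distC lip.
apply/seteqP; split=> x /=.
  move=> Ax; have /nbhs_eball[e e0 eA] : nbhs x A by exact: open_nbhs_nbhs.
  apply: (lt_le_trans e0); apply: lb_le_inf => // _ [z nAz <-].
  by rewrite leNgt; apply/negP => xz; apply/nAz/eA; rewrite /eball /= enorm_distC.
move=> x0; apply: contrapT => nAx; move: x0; rewrite ltNge => /negP; apply.
by apply: ge_inf => //; exists x => //; rewrite subrr enorm0.
Qed.

Lemma hausdorff_measurable_closed A : closed A -> measurable (A : set T).
Proof.
move=> cA; rewrite -(setCK A); apply: (@measurableC _ T).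
by apply: hausdorff_measurable_open; exact: closed_openC.
Qed.

End hausdorff_borel.


(** * Measurability of logarithms and of continuous functions *)

Section log_measurability.
Variables (d : measure_display) (T : measurableType d) (R : realType).

(** For real c, lne g > c is equivalent to g > e^c, also where g <= 0, since [lne] is -oo there. *)
Lemma measurable_lne (D : set T) (g : T -> R) :
  measurable_fun D g -> measurable_fun D ((fun x => lne (g x)%:E) : T -> \bar R).
Proof.
move=> mg mD; apply: (measurability _ (ErealGenOInfty.measurableE R)) => //.
move=> /= _ [_ [c ->]] <-.
rewrite (_ : _ @^-1` _ = g @^-1` `]expR c, +oo[); last first.
  apply/seteqP; split=> x; rewrite /= !in_itv/= ?leey ?andbT.
    case: ifPn => // g0; rewrite lte_fin -[X in c < X]/(ln (g x)) => h.
    by rewrite -(@lnK _ (g x)) ?ltr_expR// posrE ltNge.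
  move=> cg; have g0 : 0 < g x by exact: lt_trans (expR_gt0 _) cg.
  by rewrite leNgt g0/= lte_fin -ltr_expR lnK.
by apply: mg => //; exact: measurable_itv.
Qed.

End log_measurability.

Section hausdorff_measurable_functions.
Variables (R : realType) (n : nat) (d : R).
Let T := caratheodory_type (hausdorff_outer n d).

Lemma hausdorff_measurable_continuous (D : set CV[R]_n) (g : CV[R]_n -> R) :
  open D -> (forall x, D x -> {for x, continuous g}) ->
  measurable_fun (D : set T) (g : T -> R).
Proof.
move=> oD cg mD; apply: (measurability _ (RGenOInfty.measurableE R)) => //.
move=> /= _ [_ [c ->]] <-; apply: hausdorff_measurable_open.
rewrite openE => x [Dx /= cx].
apply: filterI; first by move: oD; rewrite openE; exact.
apply: cg => //; apply: open_nbhs_nbhs; split=> //.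
Qed.

End hausdorff_measurable_functions.

(** * Measure of balls in an Ahlfors regular set *)

Section regular_sets.
Variables (R : realType) (n : nat) (d a b : R).
Hypotheses (d0 : 0 < d) (a0 : 0 < a) (b0 : 0 < b).
Variable K : set CV[R]_n.
Hypotheses (regK : regular_class d a b K) (K0 : (0 < diam K)%E).
Local Open Scope ereal_scope.
Notation mu := (hausdorff_measure n d).
Let T := caratheodory_type (hausdorff_outer n d).

Let cK : compact K := regK.1.

Let small_radius : exists2 s : R, (0 < s)%R & s%:E <= diam K.
Proof.
case: (diam K) K0 => [s s0|_|//]; first by exists s.
by exists 1%R => //; exact: leey.
Qed.

Lemma regular_measurable : measurable (K : set T).
Proof.
apply: hausdorff_measurable_closed.
exact: (compact_closed (@norm_hausdorff _ _) cK).
Qed.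

Lemma regular_ball_measurable x s : measurable (eball x s `&` K : set T).
Proof.
apply: (@measurableI _ T); last exact: regular_measurable.
exact/hausdorff_measurable_open/open_eball.
Qed.

Lemma regular_measure_lty : mu K < +oo.
Proof.
have [s s0 sK] := small_radius.
have [ps psK cov] := compact_eball_cover (e := fun=> s) cK (fun _ _ => s0).
(* The induction on the list of centres needs a subset [A] in place of [K]: taking away the first
   ball leaves a set covered by the remaining ones. *)
suff ind A : A `<=` K -> (forall z, A z -> exists2 p, p \in ps & eball p s z) ->
    mu A < +oo by exact: ind.
elim: ps psK A {cov} => [|p ps IH] psK A AK cov.
  rewrite (_ : A = set0) ?measure0//; apply/seteqP; split=> // z Az.
  by have [] := cov _ Az.
apply: (@le_lt_trans _ _ (mu (eball p s `&` K) + mu (A `\` eball p s))).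
  apply: le_trans (outer_measureU2 (hausdorff_outer n d) _ _).
  apply: (le_outer_measure (hausdorff_outer n d)) => z Az.
  have [zp|zp] := pselect (eball p s z); first by left; split => //; exact: AK.
  by right.
have [_ ub] := andP (regK.2 p (psK _ (mem_head _ _)) s s0 sK).
apply: lte_add_pinfty; first exact: le_lt_trans ub (ltry _).
apply: IH => [q qps|z [Az _]|z [Az zp]]; last 2 first.
- exact: AK.
- have [q] := cov _ Az; rewrite inE => /predU1P[->//|qps qz]; by exists q.
by apply: psK; rewrite inE qps orbT.
Qed.

(** Extends the upper bound to all radii and centres. Radii above [t] cost the extra constant mu(K)
    / t^d; a centre off [K] is replaced by a point of [K] in the ball, at the price of doubling the
    radius. *)
Lemma regular_upper : exists2 a' : R, (0 < a')%R &
  forall w s, (0 < s)%R -> mu (eball w s `&` K) <= (a' * s `^ d)%:E.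
Proof.
have [t t0 tK] := small_radius.
have [m mE] : exists m : R, mu K = m%:E.
  by exists (fine (mu K)); rewrite fineK// ge0_fin_numE ?regular_measure_lty.
have m0 : (0 <= m)%R by rewrite -lee_fin -mE.
have td : (0 < t `^ d)%R by rewrite powR_gt0.
pose a1 : R := (a + m / t `^ d)%R.
have a1_gt0 : (0 < a1)%R by rewrite ltr_wpDr// divr_ge0// ltW.
have ub y s : K y -> (0 < s)%R -> mu (eball y s `&` K) <= (a1 * s `^ d)%:E.
  move=> Ky s0; have [st|ts] := leP s t.
    have sK : s%:E <= diam K by apply: le_trans tK; rewrite lee_fin.
    have /andP[_] := regK.2 y Ky s s0 sK; move/le_trans; apply.
    by rewrite lee_fin ler_wpM2r ?powR_ge0// lerDl divr_ge0// ltW.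
  apply: (@le_trans _ _ (mu K)).
    exact: (le_outer_measure (hausdorff_outer n d)) (@subIsetr _ _ _).
  rewrite mE lee_fin mulrDl (@le_trans _ _ (m / t `^ d * s `^ d)%R)//.
    rewrite -mulrA ler_peMr// mulrC ler_pdivlMr// mul1r.
    by rewrite ge0_ler_powR// ?nnegrE ltW// (lt_trans t0).
  by rewrite lerDr mulr_ge0 ?powR_ge0// ltW.
exists (a1 * 2 `^ d)%R => [|w s s0]; first by rewrite mulr_gt0// powR_gt0.
have [[y [yw Ky]]|ne] := pselect (eball w s `&` K !=set0); last first.
  rewrite (_ : _ `&` _ = set0) ?measure0 ?lee_fin ?mulr_ge0 ?powR_ge0 ?ltW//.
  by apply/seteqP; split=> // z zB; apply: ne; exists z.
rewrite -mulrA -powRM ?(ltW s0)//;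
apply: (le_trans _ (ub y (2 * s)%R Ky _)); last by rewrite mulr_gt0.
apply: (le_outer_measure (hausdorff_outer n d)); apply: setSI.
by apply: subset_eball; move: yw; rewrite /eball /= enorm_distC; lra.
Qed.

(** Extends the lower bound to radii up to [r]: with m = min(t, r), the concentric ball of radius (m
    / r) s is smaller, and its radius is at most m <= diam K. *)
Lemma regular_lower (r : R) : (0 < r)%R -> exists2 b' : R, (0 < b')%R &
  forall x s, K x -> (0 < s <= r)%R -> (b' * s `^ d)%:E <= mu (eball x s `&` K).
Proof.
move=> r0; have [t t0 tK] := small_radius.
pose m := Num.min t r; have m0 : (0 < m)%R by rewrite lt_min t0.
have mr : (m / r <= 1)%R by rewrite ler_pdivrMr// mul1r ge_min lexx orbT.
exists (b * (m / r) `^ d)%R; first by rewrite mulr_gt0// powR_gt0// divr_gt0.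
move=> x s Kx /andP[s0 sr]; have u0 : (0 < m / r * s)%R by rewrite mulr_gt0// divr_gt0.
rewrite -mulrA -powRM ?(ltW s0) ?(ltW (divr_gt0 m0 r0))//.
have uK : (m / r * s)%:E <= diam K.
  apply: le_trans tK; rewrite lee_fin (@le_trans _ _ m)//.
    by rewrite mulrAC ler_pdivrMr// ler_wpM2l// ltW.
  by rewrite ge_min lexx.
have /andP[lb _] := regK.2 x Kx _ u0 uK; apply: (le_trans lb).
apply: (le_outer_measure (hausdorff_outer n d)); apply: setSI.
apply: subset_eball; rewrite subrr enorm0 add0r -[leRHS]mul1r.
by rewrite ler_wpM2r// ltW.
Qed.

End regular_sets.


(** If N is the first index with rho / 2^N <= t, all k < N are counted and ln(rho / t) <= N ln 2.
    For t = 0 every k is counted and both sides are +oo. *)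
Lemma log_le_dyadic_count (R : realType) (rho t : R) : 0 < rho -> 0 <= t ->
  ((ln rho)%:E - lne t%:E <=
   (ln 2)%:E * \sum_(0 <= k <oo) ((t < rho / 2 ^+ k)%R%:R)%:E)%E.
Proof.
move=> rho0 t0; set G := (\sum_(0 <= k <oo) _)%E.
have ln2 : 0 < ln 2 :> R by rewrite ln_gt0// ltr1n.
have count N : (forall k, (k < N)%N -> t < rho / 2 ^+ k) -> (N%:R%:E <= G)%E.
  move=> tN; apply: le_trans (nneseries_lim_ge N _); last by move=> *; rewrite lee_fin.
  rewrite big_mkord (eq_bigr (fun=> 1%:E)) => [|k _]; last by rewrite tN.
  by rewrite sumEFin sumr_const card_ord.
move: t0; rewrite le_eqVlt => /predU1P[t0|t0].
  suff -> : G = +oo%E by rewrite gt0_muley ?lte_fin// leey.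
  apply: eq_infty => u; apply: le_trans (count (Num.bound `|u|) _).
    by rewrite lee_fin ltW// (le_lt_trans (ler_norm _))//; exact: archi_boundP.
  by move=> k _; rewrite -t0 divr_gt0// exprn_gt0.
have exN : exists N, rho / 2 ^+ N <= t.
  exists (Num.bound (rho / t)); rewrite ler_pdivrMr ?exprn_gt0//.
  rewrite mulrC -ler_pdivrMr//.
  apply: le_trans (ltW (archi_boundP _)) _; first by rewrite divr_ge0// ltW.
  by rewrite -natrX ler_nat ltnW// ltn_expl.
have [N Nt Nmin] := ex_minnP exN.
rewrite lne_EFin// -EFinB; apply: (@le_trans _ _ (ln 2 * N%:R)%:E).
  rewrite lee_fin -ln_div ?posrE// mulr_natr -lnXn//.
  rewrite ler_ln ?posrE ?divr_gt0 ?exprn_gt0// ler_pdivrMr// mulrC.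
  by rewrite -ler_pdivrMr// exprn_gt0.
rewrite EFinM lee_pmul2l ?lte_fin//; apply: count => k kN.
by rewrite ltNge; apply/negP => /Nmin; rewrite leqNgt kN.
Qed.

Lemma hausdorff_measurable_lne (R : realType) (n : nat) (d : R)
    (D A : set CV[R]_n) (g : CV[R]_n -> R) :
  open D -> (forall x, D x -> {for x, continuous g}) -> A `<=` D ->
  measurable_fun (A : set (caratheodory_type (hausdorff_outer n d)))
    ((fun z => lne (g z)%:E) : caratheodory_type (hausdorff_outer n d) -> \bar R).
Proof.
move=> oD cg AD; set T := caratheodory_type _.
have mg : measurable_fun (D : set T) (g : T -> R).
  exact: hausdorff_measurable_continuous.
have mD : measurable (D : set T) by exact: hausdorff_measurable_open.
exact: (@measurable_funS _ _ T _ D A (fun z : T => lne (g z)%:E) mD AD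
  (measurable_lne mg)).
Qed.

Lemma EFinB_ge0 (R : realDomainType) (L : R) (v : \bar R) :
  (v <= L%:E)%E -> (0 <= L%:E - v)%E.
Proof. by case: v => [v||]//; rewrite ?leey// lee_fin -EFinB lee_fin subr_ge0. Qed.

(** * Oscillation of logarithms on Ahlfors regular sets *)

Section log_oscillation.
Variables (R : realType) (n : nat) (d a b : R).
Hypotheses (d0 : 0 < d) (a0 : 0 < a) (b0 : 0 < b).
Variable K : set CV[R]_n.
Hypotheses (regK : regular_class d a b K) (K0 : (0 < diam K)%E).
Local Open Scope ereal_scope.
Notation mu := (hausdorff_measure n d).
Let T := caratheodory_type (hausdorff_outer n d).
Variables (r : R) (S : set CV[R]_n).
Hypotheses (r0 : (0 < r)%R) (Sr : S `<=` eball 0%R r).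

(** A one-sided mean oscillation bound, uniform over balls of [K] inside [S]. Since [L] dominates
    [u], the integrand is nonnegative, and the value -oo of [u] does no harm; the upper bound itself
    is what the reverse Hoelder inequality uses. *)
Definition bounded_oscillation (u : CV[R]_n -> \bar R) : Prop :=
  exists2 C : R, (0 <= C)%R & forall x s, K x -> (0 < s)%R ->
    eball x s `&` K `<=` S -> exists L : R,
    (forall z, (eball x s `&` K) z -> u z <= L%:E) /\
    \int[mu]_(z in (eball x s `&` K : set T)) (L%:E - u z) <=
      C%:E * mu (eball x s `&` K).

(** Points of [S] are less than 2 r apart, so the radius may be cut down to 2 r, the range in which
    the lower measure bound is available. *)
Let trim x s : K x -> (0 < s)%R -> eball x s `&` K `<=` S ->
  eball x s `&` K = eball x (Num.min s (2 * r))%R `&` K.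
Proof.
move=> Kx s0 BS; apply/seteqP; split=> z; rewrite /eball /= lt_min; last first.
  by move=> [/andP[]].
move=> [zx Kz]; split=> //; rewrite zx/=.
have xr : (enorm (x - 0) < r)%R.
  by apply/Sr/BS; split=> //; rewrite /eball /= subrr enorm0.
have zr : (enorm (z - 0) < r)%R by apply/Sr/BS.
have := ler_enorm_trans 0%R z x; rewrite [enorm (0 - x)%R]enorm_distC; lra.
Qed.

Let powR_dyadic (s : R) k : (0 < s)%R ->
  ((6 * s / 2 ^+ k) `^ d = (6 * s) `^ d * (2^-1 `^ d) ^+ k)%R.
Proof.
move=> s0; have s6 : (0 <= 6 * s)%R by rewrite mulr_ge0// ltW.
elim: k => [|k IH]; first by rewrite expr0 divr1 mulr1.
rewrite exprS invfM mulrCA [LHS]powRM ?invr_ge0 ?(divr_ge0 s6) ?exprn_ge0//.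
by rewrite IH exprS mulrCA.
Qed.

Lemma bounded_oscillation_log_enorm (w : CV[R]_n) :
  bounded_oscillation (fun z => lne (enorm (z - w))%:E).
Proof.
have [a' a'0 ub] := regular_upper d0 a0 regK K0.
have r2 : (0 < 2 * r)%R by rewrite mulr_gt0.
have [b' b'0 lb] := regular_lower b0 regK K0 r2.
pose q : R := (2^-1 `^ d)%R.
have q0 : (0 < q)%R by rewrite powR_gt0// invr_gt0.
have q1 : (q < 1)%R.
  suff : (2^-1 `^ d < 1 `^ d)%R by rewrite powR1.
  by rewrite gt0_ltr_powR// ?nnegrE ?invr_ge0// invf_lt1// ltr1n.
have ln2 : (0 <= ln 2 :> R)%R by rewrite ln_ge0// ler1n.
(* The sum of the geometric series of bounds a' (6 s)^d q^k, times ln 2, divided by the lower bound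
   b' s^d for mu(B). *)
pose C : R := (ln 2 * (a' * 6 `^ d / (1 - q)) / b')%R.
exists C.
  rewrite divr_ge0 ?(ltW b'0)// mulr_ge0// divr_ge0 ?subr_ge0 ?(ltW q1)//.
  by rewrite mulr_ge0 ?powR_ge0 ?(ltW a'0).
move=> x s Kx s0 BS; rewrite (trim Kx s0 BS).
have : (0 < Num.min s (2 * r) <= 2 * r)%R by rewrite lt_min s0 r2 ge_min lexx orbT.
move: (Num.min s (2 * r))%R => {BS s0}s /andP[s0 sr].
pose rho := (enorm (x - w) + s)%R.
have rho0 : (0 < rho)%R by rewrite ltr_wpDl ?enorm_ge0.
set B := eball x s `&` K.
have mB : measurable (B : set T) by exact: regular_ball_measurable regK _ _.
have mE t : measurable (eball w t : set T) by exact/hausdorff_measurable_open/open_eball.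
have rho_log z : B z -> lne (enorm (z - w))%:E <= (ln rho)%:E.
  move=> [zx Kz]; have [->|zw0] := eqVneq (enorm (z - w)) 0%R.
    by rewrite le0_lneNy ?leNye.
  have zw : (0 < enorm (z - w))%R by rewrite lt_neqAle eq_sym zw0 enorm_ge0.
  rewrite lne_EFin// lee_fin ler_ln ?posrE//.
  by have := ler_enorm_trans x z w; move: zx; rewrite /eball /= /rho; lra.
exists (ln rho); split; first exact: rho_log.
(* If [k >= 2] and the set is nonempty, then [rho <= 3 s]. *)
have EB k : mu (eball w (rho / 2 ^+ k) `&` B) <= (a' * (6 * s) `^ d * q ^+ k)%:E.
  rewrite -mulrA -powR_dyadic//.
  have k6 : (0 < 6 * s / 2 ^+ k)%R by rewrite divr_gt0 ?mulr_gt0 ?exprn_gt0.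
  (* For k <= 1 the radius 6 s / 2^k is at least 3 s, so the upper bound for [B] itself suffices. *)
  have [k2|k2] := ltnP k 2.
    apply: (@le_trans _ _ (mu B)).
      exact: (le_outer_measure (hausdorff_outer n d)) (@subIsetr _ _ _).
    apply: (le_trans (ub x s s0)); rewrite lee_fin ler_pM2l//.
    rewrite ge0_ler_powR ?nnegrE ?(ltW d0) ?(ltW s0) ?(ltW k6)//.
    rewrite ler_pdivlMr ?exprn_gt0//.
    by case: k k2 {k6} => [|[|//]] _; rewrite ?expr0 ?expr1; lra.
  have [[y [yw [yx Ky]]]|ne] := pselect (eball w (rho / 2 ^+ k) `&` B !=set0); last first.
    rewrite (_ : _ `&` _ = set0) ?measure0 ?lee_fin ?mulr_ge0 ?powR_ge0 ?ltW//.
    by apply/seteqP; split=> // z zB; apply: ne; exists z.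
  apply: (le_trans _ (ub w _ k6)).
  apply: (le_outer_measure (hausdorff_outer n d)) => z [zw [_ Kz]]; split=> //.
  move: zw; rewrite /eball /= => /lt_le_trans; apply.
  rewrite ler_pM2r ?invr_gt0 ?exprn_gt0//.
  have := ler_enorm_trans y x w; rewrite [enorm (x - y)%R]enorm_distC.
  move: yx yw; rewrite /eball /=.
  (* Together with |x - w| < s + rho / 4 this gives 3 rho < 8 s, hence rho <= 6 s. *)
  have k4 : (rho / 2 ^+ k <= rho / 4)%R.
    rewrite ler_pM2l// lef_pV2 ?posrE ?exprn_gt0//.
    by rewrite (_ : 4 = 2 ^+ 2)%R ?ler_eXn2l ?ltr1n// -natrX.
  by move: k4; rewrite /rho; lra.
have mG k : measurable_fun (B : set T)
    (fun z : T => (\1_(eball w (rho / 2 ^+ k)) z)%:E : \bar R).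
  by apply/measurable_EFinP/measurable_indic.
have mSG : measurable_fun (B : set T)
    (fun z : T => \sum_(0 <= k <oo) (\1_(eball w (rho / 2 ^+ k)%R) z)%:E : \bar R).
  by apply: ge0_emeasurable_sum => // k z _ _; rewrite lee_fin.
have mlog : measurable_fun (B : set T)
    ((fun z : T => (ln rho)%:E - lne (enorm (z - w))%:E) : T -> \bar R).
  apply: emeasurable_funB; first exact: measurable_cst.
  exact: (hausdorff_measurable_lne openT (fun z _ => @continuous_enormB R n w z)).
(* The dyadic count is integrated term by term; each indicator contributes a measure bounded by
   [EB]. *)
apply: (@le_trans _ _ (\int[mu]_(z in (B : set T))
    ((ln 2)%:E * \sum_(0 <= k <oo) (\1_(eball w (rho / 2 ^+ k)%R) z)%:E))).
  apply: ge0_le_integral; [exact: mB| |exact: mlog| |].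
  - by move=> z Bz; exact/EFinB_ge0/rho_log.
  - by apply: emeasurable_funM; [exact: measurable_cst|exact: mSG].
  move=> z _; apply: (le_trans (log_le_dyadic_count rho0 (enorm_ge0 (z - w)))).
  rewrite lee_wpmul2l ?lee_fin//.
  rewrite le_eqVlt; apply/orP; left; apply/eqP.
  apply: eq_eseriesr => k _; rewrite indicE; do 3 f_equal.
  by apply/idP/idP => [h|/set_mem//]; rewrite inE.
rewrite ge0_integralZl_EFin//; last first.
  by move=> z _; apply: nneseries_ge0 => k _ _; rewrite lee_fin.
rewrite integral_nneseries//.
have sum_le : \sum_(0 <= k <oo)
      \int[mu]_(z in (B : set T)) (\1_(eball w (rho / 2 ^+ k)%R) z)%:E <=
    (a' * (6 * s) `^ d / (1 - q))%:E.
  have A0 : (0 <= a' * (6 * s) `^ d)%R by rewrite mulr_ge0 ?powR_ge0// ltW.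
  apply: lime_le.
    apply: is_cvg_nneseries => k _ _; apply: integral_ge0 => z _.
    by rewrite lee_fin.
  near=> N; apply: (@le_trans _ _ (\sum_(0 <= k < N) (a' * (6 * s) `^ d * q ^+ k)%:E)).
    by apply: lee_sum => k _; rewrite integral_indic//; exact: EB.
  rewrite sumEFin lee_fin.
  by have := geometric_le_lim N A0 q0; rewrite gtr0_norm// => /(_ q1).
apply: (le_trans (lee_wpmul2l _ sum_le)); first by rewrite lee_fin.
apply: (@le_trans _ _ (C%:E * (b' * s `^ d)%:E)); last first.
  rewrite lee_wpmul2l ?lb ?s0// lee_fin /C.
  rewrite divr_ge0 ?(ltW b'0)// mulr_ge0// divr_ge0 ?subr_ge0 ?(ltW q1)//.
  by rewrite mulr_ge0 ?powR_ge0 ?(ltW a'0).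
rewrite -!EFinM lee_fin /C powRM// ?(ltW s0)// le_eqVlt; apply/orP; left; apply/eqP.
by field; rewrite ?subr_eq0 !gt_eqF.
Unshelve. all: by end_near. Qed.

Lemma lneM_EFin (x y : R) : (0 <= x)%R -> (0 <= y)%R ->
  lne (x * y)%:E = lne x%:E + lne y%:E.
Proof.
rewrite le_eqVlt => /predU1P[<-|x0]; first by rewrite mul0r /= lexx addNye.
rewrite le_eqVlt => /predU1P[<-|y0]; first by rewrite mulr0 /= lexx addeNy.
by rewrite EFinM lneM// in_itv/= leey andbT lte_fin.
Qed.

Lemma measurable_prod_enorm (A : set T) (ws : seq CV[R]_n) : measurable A ->
  measurable_fun A ((fun z => \prod_(w <- ws) enorm (z - w))%R : T -> R).
Proof.
move=> mA; apply: (@measurable_prod _ T R A _ ws (fun w z => enorm (z - w))) => w _.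
apply: (@measurable_funS _ _ T _ setT A _ measurableT (@subsetT _ _)).
exact: (hausdorff_measurable_continuous openT (fun z _ => @continuous_enormB R n w z)).
Qed.

Lemma bounded_oscillation_log_prod (ws : seq CV[R]_n) :
  bounded_oscillation (fun z => lne (\prod_(w <- ws) enorm (z - w))%:E).
Proof.
elim: ws => [|w ws [C2 C20 IH]].
  exists 0%R => // x s Kx s0 _; exists 0%R; split=> [z _|].
    by rewrite big_nil lne1.
  rewrite (eq_integral (cst 0)) ?integral0 ?mul0e// => z _.
  by rewrite big_nil lne1 sube0.
have [C1 C10 H1] := bounded_oscillation_log_enorm w.
exists (C1 + C2)%R; first exact: addr_ge0.
move=> x s Kx s0 BS; have [L1 [uL1 I1]] := H1 x s Kx s0 BS.
have [L2 [uL2 I2]] := IH x s Kx s0 BS.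
have mB : measurable (eball x s `&` K : set T) by exact: regular_ball_measurable regK _ _.
have prod0 (v : seq CV[R]_n) z : (0 <= \prod_(w <- v) enorm (z - w))%R.
  by apply: prodr_ge0 => *; exact: enorm_ge0.
exists (L1 + L2)%R; split=> [z Bz|].
  by rewrite big_cons lneM_EFin ?enorm_ge0// EFinD leeD ?uL1 ?uL2.
rewrite (eq_integral ((fun z : CV[R]_n => (L1%:E - lne (enorm (z - w))%:E) +
    (L2%:E - lne (\prod_(w <- ws) enorm (z - w))%:E)) : T -> \bar R)); last first.
  move=> z /set_mem Bz; rewrite big_cons lneM_EFin ?enorm_ge0//.
  have := uL1 z Bz; have := uL2 z Bz.
  (* The upper bounds exclude +oo; if one of the logarithms is -oo, both sides are +oo. *)
  case: (lne (enorm (z - w))%:E) => [u||]//; case: (lne _) => [v||]// _ _.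
  by rewrite -!(EFinB, EFinD); congr EFin; ring.
rewrite ge0_integralD; [|exact: mB| | | |].
- by rewrite EFinD ge0_muleDl ?lee_fin// leeD.
- by move=> z Bz; exact/EFinB_ge0/uL1.
- apply: emeasurable_funB; first exact: measurable_cst.
  exact: (hausdorff_measurable_lne openT (fun z _ => @continuous_enormB R n w z)).
- by move=> z Bz; exact/EFinB_ge0/uL2.
- apply: emeasurable_funB; first exact: measurable_cst.
  exact: (measurable_lne (@measurable_prod_enorm _ ws mB)).
Qed.

(** By the two comparisons, 2 ln g differs from the logarithm of the product by at most -ln c, so a
    bound for the product passes to g. *)
Lemma bounded_oscillation_comparable (g : CV[R]_n -> R) (ws : seq CV[R]_n) (c : R) :
  (0 < c)%R -> (forall z, 0 <= g z)%R ->
  (forall A : set T, measurable A -> A `<=` S -> measurable_fun A (g : T -> R)) ->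
  (forall z, S z -> c * \prod_(w <- ws) enorm (z - w) <= g z ^+ 2 <=
                    c^-1 * \prod_(w <- ws) enorm (z - w))%R ->
  bounded_oscillation (fun z => lne (g z)%:E).
Proof.
move=> c0 g0 mg gP; have [C C0 H] := bounded_oscillation_log_prod ws.
exists (C + `|ln c|)%R; first by rewrite addr_ge0.
move=> x s Kx s0 BS; have [L [uL I]] := H x s Kx s0 BS.
set B := eball x s `&` K in BS uL I *.
have mB : measurable (B : set T) by exact: regular_ball_measurable regK _ _.
have prod0 z : (0 <= \prod_(w <- ws) enorm (z - w))%R.
  by apply: prodr_ge0 => *; exact: enorm_ge0.
have gL z : B z -> lne (g z)%:E <= ((L - ln c) / 2)%:E.
  move=> Bz; have := g0 z; rewrite le_eqVlt => /predU1P[<-|gz].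
    by rewrite /= lexx leNye.
  have /andP[_ gz2] := gP z (BS z Bz).
  have P0 : (0 < \prod_(w <- ws) enorm (z - w))%R.
    rewrite lt_neqAle prod0 andbT eq_sym; apply: contraTneq gz2 => ->.
    by rewrite mulr0 -ltNge exprn_gt0.
  rewrite lne_EFin// lee_fin.
  have := uL z Bz; rewrite lne_EFin// lee_fin.
  move: gz2; rewrite -ler_ln ?posrE ?exprn_gt0 ?mulr_gt0 ?invr_gt0//.
  rewrite lnXn// lnM ?posrE ?invr_gt0// lnV ?posrE// mulr2n; lra.
exists ((L - ln c) / 2)%R; split=> //.
have mP : measurable_fun (B : set T) ((fun z => L%:E - lne
    (\prod_(w <- ws) enorm (z - w))%:E) : T -> \bar R).
  apply: emeasurable_funB; first exact: measurable_cst.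
  exact: (measurable_lne (@measurable_prod_enorm _ ws mB)).
(* The comparison gives (L - ln P) / 2 - ln c for the product P; the factor 1/2 is dropped because L
   - ln P >= 0. Where P = 0 the majorant is +oo. *)
apply: (@le_trans _ _ (\int[mu]_(z in (B : set T))
    ((L%:E - lne (\prod_(w <- ws) enorm (z - w))%:E) + `|ln c|%:E))).
  apply: ge0_le_integral; [exact: mB| | | |].
  - by move=> z Bz; exact/EFinB_ge0/gL.
  - apply: emeasurable_funB; first exact: measurable_cst.
    exact: (measurable_lne (mg _ mB BS)).
  - by apply: emeasurable_funD; [exact: mP|exact: measurable_cst].
  move=> z Bz; have /andP[gz1 _] := gP z (BS z Bz).
  have := prod0 z; rewrite le_eqVlt => /predU1P[P0|P0].
    by rewrite -P0 /= lexx leey.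
  have gz : (0 < g z)%R.
    rewrite lt_neqAle g0 andbT eq_sym; apply: contraTneq gz1 => ->.
    by rewrite -ltNge expr0n mulr_gt0.
  have := uL z Bz; rewrite !lne_EFin// -!(EFinB, EFinD) !lee_fin.
  move: gz1; rewrite -ler_ln ?posrE ?exprn_gt0 ?mulr_gt0//.
  rewrite lnXn// lnM ?posrE// mulr2n; have := ler_norm (- ln c).
  by rewrite normrN; lra.
rewrite ge0_integralD; [|exact: mB| |exact: mP| |]; last 3 first.
- by move=> z Bz; exact/EFinB_ge0/uL.
- by move=> z _; rewrite lee_fin.
- exact: measurable_cst.
by rewrite integral_cst// EFinD ge0_muleDl ?lee_fin// leeD2r.
Qed.

End log_oscillation.


(** * Order of vanishing at elliptic zeros *)

Section realification.
Variables (R : realType) (n : nat).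
Implicit Types (z p : CV[R]_n) (v w : 'rV[R]_(n + n)).

Definition realify z : 'rV[R]_(n + n) :=
  row_mx (\row_j complex.Re (z ord0 j)) (\row_j complex.Im (z ord0 j)).

Lemma realifyK : cancel realify (@complexify R n).
Proof.
move=> z; apply/rowP => j; rewrite /complexify /realify mxE row_mxKl row_mxKr.
by rewrite !mxE; case: (z ord0 j).
Qed.

Lemma complexifyD v w : complexify (v + w) = complexify v + complexify w.
Proof. by apply/rowP => j; rewrite !mxE. Qed.

Lemma sqr_enorm_complexify v : enorm (complexify v) ^+ 2 = \sum_i v ord0 i ^+ 2.
Proof.
rewrite sqr_enorm big_split_ord/= -big_split/=; apply: eq_bigr => j _.
by rewrite !mxE sqr_sqrtr// addr_ge0// sqr_ge0.
Qed.

Lemma enorm_complexifyZ (t : R) v : 0 <= t ->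
  unit_sphere v -> enorm (complexify (t *: v)) = t.
Proof.
move=> t0 v1; apply/eqP; rewrite -(eqrXn2 (ltn0Sn 1)) ?enorm_ge0//.
rewrite sqr_enorm_complexify (eq_bigr (fun i => t ^+ 2 * v ord0 i ^+ 2)).
  by rewrite -mulr_sumr v1 mulr1.
by move=> i _; rewrite mxE exprMn.
Qed.

Lemma polar_decomposition z v : z != complexify v ->
  exists2 theta : 'rV[R]_(n + n), unit_sphere theta &
    z = complexify (v + enorm (z - complexify v) *: theta).
Proof.
move=> zv; set t := enorm _.
have t0 : t != 0.
  by apply: contra zv => /eqP /enorm_eq0 /eqP; rewrite subr_eq0.
exists (t^-1 *: realify (z - complexify v)).
  rewrite /unit_sphere /= (eq_bigr (fun i => t ^- 2 * realify (z - complexify v) ord0 i ^+ 2)).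
    by rewrite -mulr_sumr -sqr_enorm_complexify realifyK mulVf// expf_neq0.
  by move=> i _; rewrite mxE exprMn exprVn.
by rewrite scalerA divff// scale1r complexifyD realifyK addrC subrK.
Qed.

End realification.

Section family_norm_theory.
Variables (R : realType) (n : nat) (f : 'I_n -> CV[R]_n -> Cplx R).

Lemma family_norm_ge0 z : 0 <= family_norm f z.
Proof. exact: enorm_ge0. Qed.

Lemma continuous_family_norm (D : set CV[R]_n) z :
  (forall i, holomorphic_on D (f i)) -> D z -> {for z, continuous (family_norm f)}.
Proof.
move=> holf Dz.
have fz i (e : R) : 0 < e -> \forall y \near z, Normc.normc (f i z - f i y) < e.
  move=> e0; have := differentiable_continuous (holf i z Dz).
  move=> /(_ [set u | Normc.normc (f i z - u) < e]); apply.
  apply/nbhs_ballP; exists ((e%:C)%C : Cplx R); first by rewrite /= ltcE /= eqxx.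
  by move=> u; rewrite /ball/= normr_Cplx ltcE /= => /andP[].
apply/cvgrPdist_le; first exact: (@nbhs_filter CV[R]_n z).
move=> e e0; pose e' := e / n.+1%:R.
have e'0 : 0 < e' by rewrite divr_gt0.
have : \forall y \near z, forall i, Normc.normc (f i z - f i y) < e'.
  apply: (@filter_forall _ _ (fun i y => Normc.normc (f i z - f i y) < e') _
    (@nbhs_filter CV[R]_n z)) => i.
  exact: fz.
apply: filterS => y fy; rewrite (le_trans (ler_dist_enorm _ _))//.
apply: (@le_trans _ _ (n%:R * e')).
  by apply: enorm_le_unif => i; rewrite !mxE ltW.
by rewrite /e' mulrCA ger_pMr// ler_pdivrMr// mul1r ler_nat.
Qed.

End family_norm_theory.

Section elliptic.
Variable R : realType.

(** Ellipticity only bounds g from below. The upper bound comes from coordinates of absolute value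
    at most 1 on the sphere, which leave the sum of the absolute coefficients. *)
Lemma homogeneous_poly_fun_bounded (N m : nat) (g : 'rV[R]_N -> R) :
  homogeneous_poly_fun m g ->
  exists2 G : R, 0 <= G & forall theta, unit_sphere theta -> `|g theta| <= G.
Proof.
move=> [c gE].
exists (\sum_(k : {ffun 'I_N -> 'I_m.+1} | (\sum_i k i)%N == m) `|c k|).
  exact: sumr_ge0.
move=> theta th1; rewrite gE (le_trans (ler_norm_sum _ _ _))// ler_sum// => k _.
rewrite normrM ler_piMr// normr_prod prodr_ile1// => i _.
rewrite normr_ge0 normrX exprn_ile1//.
rewrite -(ler_pXn2r (ltn0Sn 1)) ?nnegrE// expr1n real_normK ?num_real//.
rewrite -th1 (bigD1 i)//= lerDl sumr_ge0// => j _; exact: sqr_ge0.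
Qed.

Lemma elliptic_zero_bounds (N : nat) (h : 'rV[R]_N -> R) (v : 'rV[R]_N) :
  elliptic_zero h v -> exists (m : nat) (c e : R), [/\ 0 < c, 0 < e &
    (exists theta, @unit_sphere R N theta) /\
    forall t theta, 0 < t < e -> unit_sphere theta ->
      c * t ^+ m <= h (v + t *: theta) <= c^-1 * t ^+ m].
Proof.
move=> [_ [m [g [hg Hg g0]]]].
set E := [set g theta | theta in _] in g0.
(* The infimum of a set without one is 0 by convention, so its positivity makes the sphere nonempty
   and g bounded below on it. *)
have [E0 Elb] : has_inf E.
  by apply: contrapT => /inf_out E0; move: g0; rewrite E0 ltxx.
have [G G0 gG] := homogeneous_poly_fun_bounded hg.
set gam := inf E in g0.
have gam2 : 0 < gam / 2 by rewrite divr_gt0.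
(* With remainder at most gam / 2, the quotient by t^m lies between gam / 2 and G + gam. *)
pose c := Num.min (gam / 2) (G + gam)^-1.
have c0 : 0 < c by rewrite lt_min gam2 invr_gt0 ltr_wpDl.
have [e /= e0 He] := Hg _ gam2.
exists m, c, e; split=> //; split.
  by have [_ [theta th _]] := E0; exists theta.
move=> t theta /andP[t0 te] th.
have := He t; rewrite /ball/= sub0r normrN gtr0_norm// => /(_ te t0 theta th).
have gth : gam <= g theta by apply: ge_inf => //; exists theta.
have gthG : g theta <= G by rewrite (le_trans (ler_norm _))// gG.
have tm : 0 < t ^+ m by rewrite exprn_gt0.
rewrite ler_norml => /andP[h1 h2]; apply/andP; split.
  apply: (@le_trans _ _ (gam / 2 * t ^+ m)).
    by rewrite ler_pM2r// /c ge_min lexx.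
  have : gam * t ^+ m <= t ^+ m * g theta by rewrite mulrC ler_pM2l.
  by lra.
apply: (@le_trans _ _ ((G + gam) * t ^+ m)); last first.
  rewrite ler_pM2r// -[leLHS]invrK lef_pV2 ?posrE//; first by rewrite ge_min lexx orbT.
  by rewrite invr_gt0 ltr_wpDl.
have : t ^+ m * g theta <= t ^+ m * G by rewrite ler_pM2l.
have : 0 < gam * t ^+ m by rewrite mulr_gt0.
by lra.
Qed.

End elliptic.

Section order_of_vanishing.
Variables (R : realType) (n : nat) (f : 'I_n -> CV[R]_n -> Cplx R).

(** Off the zeros, continuity gives the estimate with m = 0; at a zero it is ellipticity rewritten
    in polar coordinates around [p]. *)
Lemma family_norm_order (p : CV[R]_n) :
  {for p, continuous (family_norm f)} ->
  (family_norm f p = 0 ->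
     elliptic_zero (fun w => family_norm f (complexify w) ^+ 2) (realify p)) ->
  exists (m : nat) (c e : R), [/\ 0 < c, 0 < e,
    family_norm f p != 0 -> m = 0%N &
    forall z, eball p e z ->
      c * enorm (z - p) ^+ m <= family_norm f z ^+ 2 <= c^-1 * enorm (z - p) ^+ m].
Proof.
move=> /cvgrPdist_lt cont ell.
have near_p (k : R) : 0 < k ->
    exists2 s : R, 0 < s & forall z, eball p s z -> `|family_norm f p - family_norm f z| < k.
  by move=> /cont /nbhs_eball.
have [Fp|Fp] := eqVneq (family_norm f p) 0; last first.
  set u := family_norm f p in Fp near_p *.
  have u0 : 0 < u by rewrite lt_neqAle eq_sym Fp family_norm_ge0.
  have [|s s0 sF] := near_p (u / 2); first by rewrite divr_gt0.
  pose c := Num.min ((u / 2) ^+ 2) ((2 * u) ^+ 2)^-1.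
  have u2 : 0 < (u / 2) ^+ 2 by rewrite exprn_gt0// divr_gt0.
  have v2 : 0 < ((2 * u) ^+ 2)^-1 by rewrite invr_gt0 exprn_gt0// mulr_gt0.
  have c0 : 0 < c by rewrite lt_min u2 v2.
  exists 0%N, c, s; split=> // z /sF; rewrite expr0 !mulr1 ltr_norml => /andP[h1 h2].
  apply/andP; split.
    apply: (@le_trans _ _ ((u / 2) ^+ 2)); first by rewrite ge_min lexx.
    by rewrite ler_pXn2r// ?nnegrE; lra.
  apply: (@le_trans _ _ ((2 * u) ^+ 2)).
    by rewrite ler_pXn2r// ?nnegrE ?family_norm_ge0//; lra.
  by rewrite -[leLHS]invrK lef_pV2 ?posrE// ge_min lexx orbT.
have [m [c [e [c0 e0 [[theta0 th0] he]]]]] := elliptic_zero_bounds (ell Fp).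
(* Order 0 would keep |F|^2 above [c] arbitrarily near the zero, against continuity. At z = p the
   estimate needs 0^m = 0, which fails for m = 0. *)
have m0 : m != 0%N.
  apply/eqP => m0; have k0 : 0 < Num.sqrt c by rewrite sqrtr_gt0.
  have [s s0 sF] := near_p _ k0.
  pose t := Num.min e s / 2.
  have es0 : 0 < Num.min e s by rewrite lt_min e0.
  have t0 : 0 < t by rewrite divr_gt0.
  have tes : t < Num.min e s by rewrite /t; lra.
  move: (tes); rewrite lt_min => /andP[te ts].
  have := he t theta0; rewrite t0 te => /(_ isT th0) /andP[+ _].
  rewrite m0 expr0 mulr1; apply/negP; rewrite -ltNge.
  have := sF (complexify (realify p + t *: theta0)).
  rewrite /eball /= complexifyD realifyK addrAC subrr add0r.
  rewrite enorm_complexifyZ ?(ltW t0)// => /(_ ts).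
  rewrite Fp sub0r normrN ger0_norm ?family_norm_ge0// => h.
  rewrite -(sqr_sqrtr (ltW c0)) ltr_pXn2r// nnegrE ?family_norm_ge0// ltW//.
exists m, c, e; split=> //.
move=> z zp; have [->|zp0] := eqVneq z p.
  by rewrite Fp subrr enorm0 !expr0n (negbTE m0)/= !mulr0 lexx.
have [theta th zE] : exists2 theta, unit_sphere theta &
    z = complexify (realify p + enorm (z - p) *: theta).
  have := @polar_decomposition _ _ z (realify p); rewrite realifyK; exact.
rewrite [in family_norm f z]zE; apply: he => //; rewrite zp andbT.
rewrite lt_neqAle enorm_ge0 andbT eq_sym.
by apply: contra zp0 => /eqP /enorm_eq0 /eqP; rewrite subr_eq0.
Qed.

End order_of_vanishing.


(** * Comparison of |F|^2 with a finite product of distances *)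

Lemma prod_flatten_nseq (A : Type) (R : comNzRingType) (m : A -> nat) (g : A -> R)
    (us : seq A) :
  \prod_(w <- flatten [seq nseq (m p) p | p <- us]) g w = \prod_(p <- us) g p ^+ m p.
Proof.
elim: us => [|p us IH]; first by rewrite !big_nil.
rewrite /= big_cat big_cons IH; congr (_ * _).
by elim: (m p) => [|k IHk]; rewrite /= ?big_nil ?big_cons ?IHk ?exprS.
Qed.

Lemma uniform_lower_bound (A : eqType) (R : realFieldType) (c : A -> R) (us : seq A) :
  (forall p, p \in us -> 0 < c p) ->
  exists2 k, 0 < k & forall p, p \in us -> k <= c p.
Proof.
elim: us => [|p us IH] c0; first by exists 1.
have [q qus|k k0 kc] := IH; first by rewrite c0// inE qus orbT.
exists (Num.min k (c p)); first by rewrite lt_min k0 c0// mem_head.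
by move=> q; rewrite inE ge_min => /predU1P[->|/kc ->//]; rewrite lexx orbT.
Qed.

Section vanishing_on_compact.
Variables (R : realType) (n : nat) (F : CV[R]_n -> R) (S : set CV[R]_n) (r : R).
Hypotheses (r0 : 0 < r) (Sr : S `<=` eball 0 r) (cS : compact S).

(** [mce] packs the order, the comparison constant and the radius, so that one choice function
    provides all three. *)
Definition vanishing_order (p : CV[R]_n) (mce : nat * R * R) :=
  [/\ 0 < mce.1.2, 0 < mce.2, F p != 0 -> mce.1.1 = 0%N &
    forall z, eball p mce.2 z ->
      mce.1.2 * enorm (z - p) ^+ mce.1.1 <= F z ^+ 2 <=
      mce.1.2^-1 * enorm (z - p) ^+ mce.1.1].

(** Balls of half the radius of validity cover [S]. On the ball of [p] the factor of [p] is
    comparable to |F|^2, while every other centre of nonzero order stays away, so its factor lies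
    between positive constants. *)
Lemma comparable_prod_enorm :
  (forall p, S p -> exists mce, vanishing_order p mce) ->
  exists (ws : seq CV[R]_n) (c : R), 0 < c /\ forall z, S z ->
    c * \prod_(w <- ws) enorm (z - w) <= F z ^+ 2 <=
    c^-1 * \prod_(w <- ws) enorm (z - w).
Proof.
move=> ordF.
have [p|data dataP] := @choice _ _ (fun p mce => S p -> vanishing_order p mce).
  have [/ordF[mce h]|nSp] := pselect (S p); first by exists mce.
  by exists (0%N, 0, 0).
pose m p := (data p).1.1; pose c p := (data p).1.2; pose e p := (data p).2.
have c0 p : S p -> 0 < c p by move=> /dataP[].
have e0 p : S p -> 0 < e p by move=> /dataP[].
have m0 p : S p -> F p != 0 -> m p = 0%N by move=> /dataP[].
have oF p z : S p -> eball p (e p) z ->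
    c p * enorm (z - p) ^+ m p <= F z ^+ 2 <= (c p)^-1 * enorm (z - p) ^+ m p.
  by move=> /dataP[_ _ _]; apply.
have e20 p : S p -> 0 < e p / 2 by move=> Sp; rewrite divr_gt0 ?e0.
have [ps psS cov] := compact_eball_cover cS e20.
(* Each centre must count once, or its factor would enter with too large a power. *)
pose us := undup ps.
have usS p : p \in us -> S p by rewrite mem_undup; exact: psS.
(* A nonzero order at [q] means that F vanishes there, whereas the lower bound around [p] keeps F
   nonzero on the ball of radius [e p] off its centre. *)
have sep p q : p \in us -> q \in us -> q != p -> m q != 0%N -> e p <= enorm (q - p).
  move=> pus qus qp mq; rewrite leNgt; apply/negP => qep.
  have Fq : F q = 0.
    by apply/eqP; apply: contraNT mq => Fq; apply/eqP/m0 => //; exact: usS.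
  have /andP[+ _] := oF p q (usS _ pus) qep.
  rewrite Fq expr0n/= leNgt => /negP; apply.
  apply: mulr_gt0; first exact/c0/usS.
  apply: exprn_gt0.
  rewrite lt_neqAle enorm_ge0 andbT eq_sym.
  by apply: contra qp => /eqP /enorm_eq0 /eqP; rewrite subr_eq0.
(* By [sep], points of the half ball have distance at least e p / 2 to the other zeros; 2 r bounds
   distances in [S] from above. *)
pose del p := Num.min (e p / 2) (2 * r)^-1.
have del0 p : p \in us -> 0 < del p.
  by move=> pus; rewrite lt_min (e20 _ (usS _ pus)) invr_gt0 mulr_gt0.
pose k p := \prod_(q <- us | q != p) del p ^+ m q.
have k0 p : p \in us -> 0 < k p.
  by move=> pus; apply: prodr_gt0 => q _; rewrite exprn_gt0 ?del0.
have far p z q : p \in us -> q \in us -> q != p -> S z -> eball p (e p / 2) z ->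
    del p ^+ m q <= enorm (z - q) ^+ m q <= del p ^- m q.
  move=> pus qus qp Sz zp; have [->|mq] := eqVneq (m q) 0%N; first by rewrite invr1 lexx.
  have dp := del0 p pus.
  have lo : del p <= enorm (z - q).
    have := sep p q pus qus qp mq; have := ler_enorm_trans z q p.
    rewrite [enorm (q - z)]enorm_distC; move: zp; rewrite /eball /= => h1 h2 h3.
    by rewrite ge_min; apply/orP; left; lra.
  have hi : enorm (z - q) <= (del p)^-1.
    apply: (@le_trans _ _ (2 * r)); last first.
      by rewrite -[leLHS]invrK lef_pV2 ?posrE// ?invr_gt0 ?mulr_gt0// ge_min lexx orbT.
    have := ler_enorm_trans 0 z q; rewrite [enorm (0 - q)]enorm_distC.
    have := Sr Sz; have := Sr (usS _ qus); rewrite /eball /=; lra.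
  rewrite -exprVn !lerXn2r ?nnegrE ?enorm_ge0 ?invr_ge0 ?(ltW dp)//.
have rest p z : p \in us -> S z -> eball p (e p / 2) z ->
    k p <= \prod_(q <- us | q != p) enorm (z - q) ^+ m q <= (k p)^-1.
  move=> pus Sz zp; have dp := del0 p pus.
  have mono (E1 E2 : CV[R]_n -> R) :
      (forall q, q \in us -> q != p -> 0 <= E1 q <= E2 q) ->
      \prod_(q <- us | q != p) E1 q <= \prod_(q <- us | q != p) E2 q.
    move=> E12; rewrite big_seq_cond [leRHS]big_seq_cond ler_prod// => q /andP[].
    exact: E12.
  rewrite /k -prodfV; apply/andP; split; apply: mono => q qus qp.
    have /andP[-> _] := far p z q pus qus qp Sz zp.
    by rewrite exprn_ge0// ltW.
  have /andP[_ ->] := far p z q pus qus qp Sz zp.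
  by rewrite exprn_ge0// enorm_ge0.
have [C C0 Cle] := @uniform_lower_bound _ _ (fun p => c p * k p) us
  (fun p pus => mulr_gt0 (c0 p (usS p pus)) (k0 p pus)).
exists (flatten [seq nseq (m p) p | p <- us]), C; split=> // z Sz.
have [p pps zp] := cov z Sz; have pus : p \in us by rewrite mem_undup.
rewrite prod_flatten_nseq (bigD1_seq p)//= ?undup_uniq//.
have /andP[lo hi] := rest p z pus Sz zp.
set Q := \prod_(q <- us | q != p) _ in lo hi *.
have zpe : eball p (e p) z.
  by move: zp; rewrite /eball /=; have := e0 p (usS _ pus); lra.
have /andP[Flo Fhi] := oF p z (usS _ pus) zpe.
set E := enorm (z - p) ^+ m p in Flo Fhi *.
have E0 : 0 <= E by rewrite exprn_ge0// enorm_ge0.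
have kp := k0 p pus; have cp := c0 p (usS _ pus).
have Q0 : 0 < Q by exact: lt_le_trans lo.
apply/andP; split.
  apply: le_trans Flo; apply: (@le_trans _ _ (c p * k p * (E * Q))).
    by rewrite ler_wpM2r ?Cle// mulr_ge0// ltW.
  rewrite -mulrA ler_pM2l// mulrCA ler_piMr//.
  by rewrite mulrC -ler_pdivlMr// mul1r.
apply: (le_trans Fhi); apply: (@le_trans _ _ ((c p * k p)^-1 * (E * Q))); last first.
  rewrite ler_wpM2r ?mulr_ge0 ?(ltW Q0)// lef_pV2 ?posrE ?Cle//.
  by rewrite mulr_gt0.
rewrite invfM -mulrA ler_pM2l ?invr_gt0// mulrCA ler_peMr//.
by rewrite mulrC ler_pdivlMr// mul1r.
Qed.

End vanishing_on_compact.


(** * From oscillation to reverse Hoelder and BMO *)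

Section averages.
Variables (dsp : measure_display) (T : measurableType dsp) (R : realType).
Variables (mu : {measure set T -> \bar R}) (B : set T) (m L C : R).
Hypotheses (mB : measurable B) (muB : mu B = m%:E) (m0 : 0 < m) (C0 : 0 <= C).
Local Open Scope ereal_scope.

(** Jensen's inequality for a logarithm that may be -oo: integrating a tangent line inequality with
    k = e^(C - L) gives (1 + C) m <= k times the integral of g, plus C m, and the finite term C m
    cancels. *)
Lemma expR_mean_log_le (g : T -> R) : (forall z, 0 <= g z)%R ->
  measurable_fun B g -> (forall z, B z -> lne (g z)%:E <= L%:E) ->
  \int[mu]_(z in B) (L%:E - lne (g z)%:E) <= C%:E * m%:E ->
  (expR L)%:E <= (expR C)%:E * (m^-1%:E * \int[mu]_(z in B) (g z)%:E).
Proof.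
move=> g0 mg gL gC.
have mv : measurable_fun B ((fun z => L%:E - lne (g z)%:E) : T -> \bar R).
  by apply: emeasurable_funB; [exact: measurable_cst|exact: measurable_lne].
have mgE : measurable_fun B ((fun z => (g z)%:E) : T -> \bar R).
  exact/measurable_EFinP.
pose k := expR (C - L).
have k0 : (0 < k)%R by exact: expR_gt0.
have mkg : measurable_fun B ((fun z => k%:E * (g z)%:E) : T -> \bar R).
  by apply: emeasurable_funM; [exact: measurable_cst|exact: mgE].
(* The tangent line inequality [1 + t <= expR t] at [t = C - L + ln (g z)]. *)
have pointwise z : B z -> (1 + C)%:E <= k%:E * (g z)%:E + (L%:E - lne (g z)%:E).
  move=> Bz; have := g0 z; rewrite le_eqVlt => /predU1P[<-|gz].
    by rewrite mule0 add0e /= lexx leey.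
  rewrite lne_EFin// -!(EFinB, EFinM, EFinD) lee_fin.
  have := expR_ge1Dx (C - L + ln (g z)); rewrite expRD lnK ?posrE// -/k; lra.
have I0 : 0 <= \int[mu]_(z in B) (g z)%:E.
  by apply: integral_ge0 => z _; rewrite lee_fin.
have : (1 + C)%:E * m%:E <= k%:E * \int[mu]_(z in B) (g z)%:E + C%:E * m%:E.
  apply: le_trans (leeD2l _ gC).
  rewrite -ge0_integralZl_EFin//; [|by move=> z _; rewrite lee_fin|exact: ltW].
  rewrite -ge0_integralD; [|exact: mB| |exact: mkg| |exact: mv].
  - rewrite -muB -integral_cst//; apply: ge0_le_integral; [exact: mB| | | |].
    + by move=> z _; rewrite lee_fin addr_ge0.
    + exact: measurable_cst.
    + by apply: emeasurable_funD; [exact: mkg|exact: mv].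
    + exact: pointwise.
  - by move=> z _; rewrite lee_fin mulr_ge0// ltW.
  - by move=> z Bz; exact/EFinB_ge0/gL.
rewrite EFinD ge0_muleDl ?lee_fin// mul1e leeD2rE// => mI.
have cE : (expR C)%:E * (m^-1)%:E = (expR L / m)%:E * k%:E.
  rewrite -!EFinM /k expRD expRN; congr EFin; field.
  by rewrite !gt_eqF ?expR_gt0.
rewrite muleA cE -muleA; apply: le_trans (lee_wpmul2l _ mI).
  by rewrite -EFinM divfK ?gt_eqF.
by rewrite lee_fin divr_ge0 ?expR_ge0// ltW.
Qed.

Lemma power_mean_le_sup (g : T -> R) (p A : R) : (0 < p)%R -> (0 <= A)%R ->
  (forall z, 0 <= g z)%R -> measurable_fun B g -> (forall z, B z -> g z <= A)%R ->
  (m^-1%:E * \int[mu]_(z in B) (g z `^ p)%:E) `^ p^-1 <= A%:E.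
Proof.
move=> p0 A0 g0 mg gA.
have Ip : \int[mu]_(z in B) (g z `^ p)%:E <= (A `^ p)%:E * m%:E.
  rewrite -muB -integral_cst//; apply: ge0_le_integral; [exact: mB| | | |].
  - by move=> z _; rewrite lee_fin powR_ge0.
  - apply/measurable_EFinP.
    exact: (measurableT_comp (measurable_powR p) mg).
  - exact: measurable_cst.
  - by move=> z Bz; rewrite lee_fin ge0_ler_powR ?nnegrE ?(ltW p0)// gA.
have I0 : 0 <= \int[mu]_(z in B) (g z `^ p)%:E.
  by apply: integral_ge0 => z _; rewrite lee_fin powR_ge0.
have -> : A%:E = (A `^ p)%:E `^ p^-1.
  by rewrite poweR_EFin -powRrM mulfV ?gt_eqF// powRr1.
apply: gt0_ler_poweR.
- by rewrite invr_ge0 ltW.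
- by rewrite in_itv/= leey mule_ge0// lee_fin invr_ge0 ltW.
- by rewrite in_itv/= leey lee_fin powR_ge0.
apply: (le_trans (lee_wpmul2l _ Ip)); first by rewrite lee_fin invr_ge0 ltW.
by rewrite -!EFinM lee_fin mulrCA mulVf ?gt_eqF// mulr1.
Qed.

Variable u : T -> \bar R.
Hypotheses (mu_u : measurable_fun B u) (uL : forall z, B z -> u z <= L%:E).
Hypothesis uC : \int[mu]_(z in B) (L%:E - u z) <= C%:E * m%:E.

Let mv : measurable_fun B ((fun z => L%:E - u z) : T -> \bar R).
Proof. by apply: emeasurable_funB; [exact: measurable_cst|]. Qed.

Let v_ge0 z : B z -> 0 <= L%:E - u z.
Proof. by move=> Bz; exact/EFinB_ge0/uL. Qed.

(** Pointwise |u - A| <= (L - u) + |L - A|, and both sides are +oo where u = -oo. *)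
Let dist_le (A c : R) : (`|L - A| <= c)%R ->
  \int[mu]_(z in B) `|u z - A%:E| <= (C + c)%:E * m%:E.
Proof.
move=> LAc; have c0 : (0 <= c)%R by exact: le_trans LAc.
apply: (@le_trans _ _ (\int[mu]_(z in B) ((L%:E - u z) + c%:E))).
  apply: ge0_le_integral; [exact: mB| | | |].
  - by move=> z _; exact: abse_ge0.
  - apply: measurableT_comp => //.
    by apply: emeasurable_funB; [|exact: measurable_cst].
  - by apply: emeasurable_funD; [exact: mv|exact: measurable_cst].
  - move=> z Bz; have := uL Bz; case: (u z) => [w| |]//=.
    rewrite -!(EFinB, EFinD) !lee_fin => wL.
    have := ler_distD L w A; have : (`|w - L| = L - w)%R.
      by rewrite distrC ger0_norm// subr_ge0.
    by move=> -> h; apply: (le_trans h); rewrite lerD2l.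
rewrite ge0_integralD; [|exact: mB|exact: v_ge0|exact: mv| |exact: measurable_cst].
  by rewrite integral_cst// muB EFinD ge0_muleDl ?lee_fin// leeD2r.
by move=> z _; rewrite lee_fin.
Qed.

Lemma integrable_of_oscillation : mu.-integrable B u.
Proof.
apply/integrableP; split=> //.
rewrite (eq_integral (fun z => `|u z - 0%:E|)); last by move=> z _; rewrite sube0.
by apply: (le_lt_trans (@dist_le 0%R `|L|%R _)); rewrite ?subr0// -EFinM ltry.
Qed.

(** L minus the mean of u is the mean of L - u, hence lies in [0, C]; [dist_le] around the mean then
    adds a second C. *)
Lemma mean_oscillation_le :
  m^-1%:E * \int[mu]_(z in B) `|u z - m^-1%:E * \int[mu]_(y in B) u y| <= (C + C)%:E.
Proof.
have iu := integrable_of_oscillation.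
have icst : mu.-integrable B (cst L%:E).
  apply/integrableP; split; first exact: measurable_cst.
  by rewrite integral_cst// muB -EFinM ltry.
have [J JE] : exists J : R, \int[mu]_(y in B) u y = J%:E.
  by exists (fine (\int[mu]_(y in B) u y)); rewrite fineK// integrable_fin_num.
have vE : \int[mu]_(z in B) (L%:E - u z) = (L * m - J)%:E.
  by rewrite (integralB mB icst iu) integral_cst// muB JE -EFinM -EFinB.
have vC : (L * m - J <= C * m)%R by rewrite -lee_fin -vE EFinM.
have v0 : (0 <= L * m - J)%R.
  by rewrite -lee_fin -vE; apply: integral_ge0 => z Bz; exact: v_ge0.
rewrite JE -EFinM.
have LA : (`|L - m^-1 * J| <= C)%R.
  have -> : (L - m^-1 * J = (L * m - J) / m)%R by field; rewrite gt_eqF.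
  by rewrite ger0_norm ?divr_ge0 ?(ltW m0)// ler_pdivrMr.
apply: (le_trans (lee_wpmul2l _ (dist_le LA))); first by rewrite lee_fin invr_ge0 ltW.
by rewrite -!EFinM lee_fin mulrCA mulVf ?gt_eqF// mulr1.
Qed.

End averages.


Section hausdorff_averages.
Variables (R : realType) (n : nat) (d : R).
Local Open Scope ereal_scope.
Notation mu := (hausdorff_measure n d).
Let T := caratheodory_type (hausdorff_outer n d).
Implicit Types (B K : set CV[R]_n).

Let averageE B (m : R) (v : CV[R]_n -> \bar R) : (0 < m)%R -> mu B = m%:E ->
  average d B v = m^-1%:E * \int[mu]_(z in (B : set T)) v z.
Proof. by move=> m0 muB; rewrite /average muB inver gt_eqF. Qed.

Lemma reverse_Holder_of_oscillation B (m L C : R) (g : CV[R]_n -> R) :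
  measurable (B : set T) -> mu B = m%:E -> (0 < m)%R -> (0 <= C)%R ->
  (forall z, 0 <= g z)%R -> measurable_fun (B : set T) (g : T -> R) ->
  (forall z, B z -> lne (g z)%:E <= L%:E) ->
  \int[mu]_(z in (B : set T)) (L%:E - lne (g z)%:E) <= C%:E * mu B ->
  reverse_Holder d (expR C) B g.
Proof.
move=> mB muB m0 C0 g0 mg gL gC p p1; rewrite (averageE _ m0 muB).
rewrite muB in gC.
apply: le_trans (@expR_mean_log_le _ T R mu B m L C mB muB m0 C0 g g0 mg gL gC).
have gexp z : B z -> (g z <= expR L)%R.
  move=> Bz; have := g0 z; rewrite le_eqVlt => /predU1P[<-|gz]; first exact: expR_ge0.
  have := gL z Bz; rewrite lne_EFin// lee_fin => h.
  by rewrite -[g z]lnK ?posrE// ler_expR.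
case: p p1 => [p| |]//=.
  rewrite lee_fin => p1; have p0 : (0 < p)%R by exact: lt_le_trans p1.
  rewrite (averageE _ m0 muB).
  exact: (@power_mean_le_sup _ T R mu B m mB muB m0 g p _ p0 (expR_ge0 L) g0 mg gexp).
by move=> _; apply: ge_ereal_sup => _ [z Bz <-]; rewrite lee_fin gexp.
Qed.

Lemma BMO_of_oscillation K (C : R) (u : CV[R]_n -> \bar R) :
  (0 <= C)%R -> measurable (K : set T) -> measurable_fun (K : set T) (u : T -> \bar R) ->
  (forall x s, K x -> (0 < s)%R -> exists m L : R,
     [/\ mu (eball x s `&` K) = m%:E, (0 < m)%R,
       forall z, (eball x s `&` K) z -> u z <= L%:E &
       \int[mu]_(z in (eball x s `&` K : set T)) (L%:E - u z) <=
         C%:E * mu (eball x s `&` K)]) ->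
  BMO d K u.
Proof.
move=> C0 mK uK H.
have mB x s : measurable (eball x s `&` K : set T).
  by apply: (@measurableI _ T) => //; exact/hausdorff_measurable_open/open_eball.
have uB x s : measurable_fun (eball x s `&` K : set T) (u : T -> \bar R).
  exact: (@measurable_funS _ _ T _ K (eball x s `&` K) u mK (@subIsetr _ _ _) uK).
split=> [x Kx|].
  exists 1%R => //; have [m [L [muB m0 uL uC]]] := H x 1%R Kx ltr01.
  rewrite muB in uC.
  exact: (@integrable_of_oscillation _ T R mu _ m L C (mB x 1%R) muB C0 u (uB x 1%R) uL uC).
apply: (@le_lt_trans _ _ (C + C)%:E); last exact: ltry.
apply: ge_ereal_sup => _ [_ [x [s [Kx s0 ->]]] <-].
have [m [L [muB m0 uL uC]]] := H x s Kx s0; rewrite muB in uC.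
rewrite !(averageE _ m0 muB).
exact: (@mean_oscillation_le _ T R mu _ m L C (mB x s) muB m0 C0 u (uB x s) uL uC).
Qed.

(** Serves a set [K] with at most one point. Integrals over null sets vanish, and the averages are
    +oo times 0, that is 0. *)
Lemma BMO_of_null K (u : CV[R]_n -> \bar R) :
  measurable (K : set T) -> measurable_fun (K : set T) (u : T -> \bar R) ->
  mu K = 0 -> BMO d K u.
Proof.
move=> mK uK K0.
have mB x s : measurable (eball x s `&` K : set T).
  by apply: (@measurableI _ T) => //; exact/hausdorff_measurable_open/open_eball.
have muB x s : mu (eball x s `&` K) = 0.
  apply/eqP; rewrite eq_le measure_ge0 andbT -K0.
  exact: (le_outer_measure (hausdorff_outer n d)) (@subIsetr _ _ _).
have uB x s : measurable_fun (eball x s `&` K : set T) (u : T -> \bar R).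
  exact: (@measurable_funS _ _ T _ K (eball x s `&` K) u mK (@subIsetr _ _ _) uK).
split=> [x Kx|].
  exists 1%R => //; apply/integrableP; split; first exact: uB.
  by rewrite (integral_abs_eq0 (mB x 1%R) (uB x 1%R) (muB x 1%R)).
apply: (@le_lt_trans _ _ 0); last exact: ltry.
apply: ge_ereal_sup => _ [_ [x [s [Kx s0 ->]]] <-].
move: (average d _ u) => A.
have mA : measurable_fun (eball x s `&` K : set T)
    ((fun z => `|u z - A|) : T -> \bar R).
  apply: measurableT_comp; first exact: abse_measurable.
  by apply: emeasurable_funB; [exact: uB|exact: measurable_cst].
by rewrite /average (null_set_integral (mB x s) mA (muB x s)) mule0.
Qed.

(** [K] alone, padded with [set0], is a cover at every mesh, and 0^d = 0 as d > 0. *)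
Lemma hausdorff_diam_le0 K : (0 < d)%R -> diam K <= 0 -> mu K = 0.
Proof.
move=> d0 K0; apply/eqP; rewrite eq_le measure_ge0 andbT.
have diamK0 : diam_pow d K = 0.
  rewrite /diam_pow; case: ifPn => // /set0P[x Kx].
  have -> : diam K = 0.
    apply/eqP; rewrite eq_le K0/=; apply: ereal_sup_ubound; exists (x, x) => //=.
    by rewrite subrr enorm0.
  by rewrite poweR_EFin powR0// gt_eqF.
apply: ge_ereal_sup => _ [e /= e0 <-]; apply: ereal_inf_lbound.
exists (fun k => if k == 0%N then K else set0).
  split=> [x Kx|[|k] /=]; first by exists 0%N.
    by apply: (le_trans K0); rewrite lee_fin ltW.
  by rewrite /diam setX0 image_set0 ereal_sup0 leNye.
by apply: eseries0 => -[|k] _ _ /=; rewrite ?diamK0// /diam_pow eqxx.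
Qed.

End hausdorff_averages.

(** * Oscillation of log |F| on K and the two conclusions *)

Section family_oscillation.
Variables (R : realType) (n : nat) (r : R) (f : 'I_n -> CV[R]_n -> Cplx R).
Hypotheses (r0 : 0 < r) (holf : forall i, holomorphic_on (eball 0 r) (f i)).
Hypothesis ellf : forall v : 'rV[R]_(n + n),
  eball 0 r (complexify v) -> family_norm f (complexify v) ^+ 2 = 0 ->
  elliptic_zero (fun w : 'rV[R]_(n + n) => family_norm f (complexify w) ^+ 2) v.
Variables (d a b : R) (K : set CV[R]_n).
Hypotheses (d0 : 0 < d) (a0 : 0 < a) (b0 : 0 < b).
Hypotheses (regK : regular_class d a b K).
Let T := caratheodory_type (hausdorff_outer n d).

Lemma measurable_family_norm (A : set T) : measurable A -> A `<=` eball 0 r ->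
  measurable_fun A (family_norm f : T -> R).
Proof.
move=> mA Ar; have mD : measurable (eball 0 r : set T).
  exact/hausdorff_measurable_open/open_eball.
apply: (@measurable_funS _ _ T _ (eball 0 r) A _ mD Ar).
apply: hausdorff_measurable_continuous; first exact: open_eball.
by move=> x; exact: continuous_family_norm.
Qed.

Lemma log_family_norm_oscillation (S : set CV[R]_n) :
  (0 < diam K)%E -> compact S -> S `<=` eball 0 r ->
  bounded_oscillation d K S (log_family_norm f).
Proof.
move=> K0 cS Sr.
have ordF p : S p -> exists mce, vanishing_order (family_norm f) p mce.
  move=> Sp; have cp := continuous_family_norm holf (Sr p Sp).
  have [|m [c [e h]]] := family_norm_order cp; last by exists (m, c, e).
  move=> Fp; apply: ellf; first by rewrite realifyK; exact: Sr.
  by rewrite realifyK Fp expr0n.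
have [ws [c [c0 cF]]] := comparable_prod_enorm r0 Sr cS ordF.
apply: (bounded_oscillation_comparable d0 a0 b0 regK K0 r0 Sr c0 _ _ cF).
  exact: family_norm_ge0.
by move=> A mA AS; apply: measurable_family_norm => //; exact: subset_trans Sr.
Qed.

(** Averages over balls of [K] are thus genuine quotients by a positive finite number. *)
Lemma regular_ball_measure x s : (0 < diam K)%E -> K x -> 0 < s ->
  exists2 m : R, 0 < m & hausdorff_measure n d (eball x s `&` K) = m%:E.
Proof.
move=> K0 Kx s0; have [b' b'0 lb] := regular_lower b0 regK K0 s0.
have [a' a'0 ub] := regular_upper d0 a0 regK K0.
have := lb x s Kx; rewrite s0 lexx => /(_ isT); have := ub x s s0.
case: (hausdorff_measure n d _) => [m| |]//; rewrite !lee_fin => _ h.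
by exists m => //; apply: lt_le_trans h; rewrite mulr_gt0// powR_gt0.
Qed.

End family_oscillation.

Theorem theorem1p7 (R : realType) (n : nat) (hn : (2 <= n)%N)
    (r : R) (hr : 2^-1 < r)
    (f : 'I_n -> CV[R]_n -> Cplx R)
    (hf : forall i, holomorphic_on (eball 0 r) (f i))
    (M : R) (hM : 0 < M)
    (hsup : (ereal_sup [set log_family_norm f z | z in eball 0 r] <= 0)%E)
    (hinf : ((- M)%:E <=
             ereal_inf [set log_family_norm f z | z in esphere 0 2^-1])%E)
    (hell : forall v : 'rV[R]_(n + n),
       eball 0 r (complexify v) -> family_norm f (complexify v) ^+ 2 = 0 ->
       elliptic_zero (fun w : 'rV[R]_(n + n) => family_norm f (complexify w) ^+ 2) v)
    (d a b : R) (hd : 0 < d) (ha : 0 < a) (hb : 0 < b)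
    (K : set CV[R]_n) (hK : regular_class d a b K) :
  ((0 < diam K)%E ->
     exists C : R, forall (x : CV[R]_n) (t : R),
       K x -> 0 < t -> eball x (4 * r ^+ 2 * t) `<=` eball 0 2^-1 ->
       reverse_Holder d C (eball x t `&` K) (family_norm f))
  /\ (K `<=` eball 0 r -> BMO d K (log_family_norm f)).
Proof.
have r0 : 0 < r by apply: lt_trans hr; rewrite invr_gt0.
have mB x s : measurable
    (eball x s `&` K : set (caratheodory_type (hausdorff_outer n d))).
  exact: regular_ball_measurable hK x s.
have mK := regular_measurable hK.
split=> [K0|Kr].
  (* The closed ball makes [S] compact, and r > 1/2 keeps it inside the domain of F. *)
  pose S := K `&` [set z | enorm (z - 0) <= 2^-1].
  have cS : compact S by apply: compact_closedI hK.1 _; exact: closed_closed_eball.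
  have Sr : S `<=` eball 0 r by move=> z [_ /= /le_lt_trans]; apply.
  have [C C0 osc] := log_family_norm_oscillation r0 hf hell hd ha hb hK K0 cS Sr.
  exists (expR C) => x t Kx t0 xt.
  have BS : eball x t `&` K `<=` S.
    move=> z [zx Kz]; split=> //=; apply/ltW/xt.
    rewrite /eball /= (lt_le_trans zx)// ler_peMl ?(ltW t0)//.
    (* From r > 1/2 follows 4 r^2 >= 1, so B(x, t) lies in B(x, 4 r^2 t). *)
    suff : 2^-1 ^+ 2 <= r ^+ 2 by rewrite exprVn; lra.
    by rewrite ler_pXn2r ?nnegrE ?invr_ge0 ?(ltW r0) ?(ltW hr).
  have [m m0 muB] := regular_ball_measure hd ha hb hK K0 Kx t0.
  have [L [FL FC]] := osc x t Kx t0 BS.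
  apply: (reverse_Holder_of_oscillation (mB x t) muB m0 C0 (@family_norm_ge0 _ _ f) _ FL FC).
  by apply: (measurable_family_norm hf (mB x t)); exact: subset_trans Sr.
have mF := measurable_lne (measurable_family_norm hf mK Kr).
have [K0|K0] := ltP 0%E (diam K); last first.
  exact: BMO_of_null mK mF (hausdorff_diam_le0 hd K0).
(* Here all of [K] serves as the compact set [S], so every ball of [K] is admissible. *)
have [C C0 osc] := log_family_norm_oscillation r0 hf hell hd ha hb hK K0 hK.1 Kr.
apply: (BMO_of_oscillation C0 mK mF) => x s Kx s0.
have [m m0 muB] := regular_ball_measure hd ha hb hK K0 Kx s0.
have [L [FL FC]] := osc x s Kx s0 (@subIsetr _ _ _).
by exists m, L.
Qed.
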